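(* Let $1\le p<\infty$, let $m\ge1$, let $X,Y$ be Banach spaces over $\mathbb{K}$ and let $P\in\mathcal{P}(^mX;Y)$. Then $P$ is factorable strongly $p$-summing if and only if there exist a regular Borel probability measure $\mu$ on $B_{\mathcal{P}(^mX)}$, endowed with the weak-star topology, and a constant $C\ge0$ such that $$\left\|\sum_{i=1}^k\lambda^iP(x^i)\right\|\le C\left(\int_{B_{\mathcal{P}(^mX)}}\left|\sum_{i=1}^k\lambda^iq(x^i)\right|^p d\mu(q)\right)^{1/p}$$ for all positive integers $k$, all $x^1,\dots,x^k\in X$ and all $\lambda^1,\dots,\lambda^k\in\mathbb{K}$.
   Context: $\mathbb{K}=\mathbb{R}$ or $\mathbb{C}$. $\mathcal{P}(^mX;Y)$ is the space of continuous $m$-homogeneous polynomials from $X$ to $Y$, and $\mathcal{P}(^mX)=\mathcal{P}(^mX;\mathbb{K})$ with the sup norm on the unit ball of $X$; $B_{\mathcal{P}(^mX)}$ is its closed unit ball. $\mathcal{P}(^mX)$ is the dual of the completed $m$-fold symmetric tensor product $\hat\otimes^{m,s}_{\pi_s}X$ (the completion of the span $\otimes^{m,s}X$ of the tensors $x\otimes\cdots\otimes x$ under $\pi_s(z)=\inf\{\sum_{j=1}^k|\lambda_j|\|x_j\|^m: z=\sum_{j=1}^k\lambda_jx_j\otimes\cdots\otimes x_j\}$), via $q(x\otimes\cdots\otimes x)=q(x)$; the weak-star topology refers to this duality, and makes $B_{\mathcal{P}(^mX)}$ compact. A polynomial $P\in\mathcal{P}(^mX;Y)$ is factorable strongly $p$-summing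 if there is $C\ge0$ such that for all positive integers $m_1,m_2$, all $x_j^i\in X$ and all scalars $\lambda_j^i$ ($1\le j\le m_1$, $1\le i\le m_2$), $$\left(\sum_{j=1}^{m_1}\Big\|\sum_{i=1}^{m_2}\lambda_j^iP(x_j^i)\Big\|^p\right)^{1/p}\le C\sup_{q\in\mathcal{P}(^mX),\,\|q\|\le1}\left(\sum_{j=1}^{m_1}\Big|\sum_{i=1}^{m_2}\lambda_j^iq(x_j^i)\Big|^p\right)^{1/p}.$$ *)

(* Defs.v *)
From HB Require Import structures.
From mathcomp Require Import all_boot all_order all_algebra.
From mathcomp Require Import complex.
From mathcomp Require Import all_classical all_reals all_analysis.

Set Implicit Arguments.
Unset Strict Implicit.
Unset Printing Implicit Defensive.

Import Order.TTheory GRing.Theory Num.Theory.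
Import numFieldNormedType.Exports.

Local Open Scope classical_set_scope.
Local Open Scope ring_scope.

Variant scalar_kind := RealScalars | ComplexScalars.

Definition scalar_field (R : realType) (s : scalar_kind) : numFieldType :=
  match s with
  | RealScalars => R
  | ComplexScalars => R[i]
  end.

(* MathComp norms of a [normedModType K] take their values in [K]; over [R[i]]
   the value is a complex number with zero imaginary part, and [rnorm] is that
   same number seen in [R]. *)
Definition real_part (R : realType) (s : scalar_kind) : scalar_field R s -> R :=
  match s with
  | RealScalars => fun a => a
  | ComplexScalars => fun a => complex.Re a
  end.

Definition rnorm (R : realType) (s : scalar_kind)
  (V : normedModType (scalar_field R s)) (v : V) : R := real_part `|v|.

Section HomogeneousPolynomials.
Context {R : realType} {s : scalar_kind}.
Local Notation K := (scalar_field R s).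

Definition multilinear (m : nat) (X Y : lmodType K)
    (A : ('I_m -> X) -> Y) : Prop :=
  forall (i : 'I_m) (x : 'I_m -> X), linear (fun v : X => A (dfwith x i v)).

(* The multilinear map itself need not be symmetric, nor assumed continuous. *)
Definition homogeneous_polynomial (m : nat) (X Y : lmodType K)
    (P : X -> Y) : Prop :=
  exists A : ('I_m -> X) -> Y, multilinear A /\ forall x, P x = A (fun=> x).

Record hompoly (m : nat) (X Y : normedModType K) := HomPoly {
  hompoly_fun :> X -> Y ;
  hompolyP : homogeneous_polynomial m hompoly_fun ;
  hompoly_continuous : continuous hompoly_fun }.

HB.instance Definition _ m X Y := gen_eqMixin (hompoly m X Y).
HB.instance Definition _ m X Y := gen_choiceMixin (hompoly m X Y).

Definition hompoly_norm (m : nat) (X Y : normedModType K)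
    (P : hompoly m X Y) : \bar R :=
  ereal_sup [set (rnorm (P x))%:E | x in [set x : X | rnorm x <= 1]].

Lemma hompoly0_subproof (m : nat) (X Y : normedModType K) :
  homogeneous_polynomial m ((fun=> 0) : X -> Y).
Proof.
exists (fun=> 0); split=> // i x a u v /=.
by rewrite scaler0 addr0.
Qed.

Definition hompoly0 (m : nat) (X Y : normedModType K) : hompoly m X Y :=
  HomPoly (@hompoly0_subproof m X Y) (fun x => cvg_cst (0 : Y)).

End HomogeneousPolynomials.

Section SymmetricTensors.
Context {R : realType} {s : scalar_kind}.
Local Notation K := (scalar_field R s).
Context (m : nat) (X : normedModType K).

Definition multilinear_form := {A : ('I_m -> X) -> K^o | multilinear A}.

(* Algebraic tensors are realized as functionals on the m-linear forms:
   x1 (x) ... (x) xm is A |-> A (x1, ..., xm).  A list of pairs (lambda_j, x_j)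
   is a formal combination representing sum_j lambda_j x_j (x) ... (x) x_j. *)
Definition diag_tensor (x : X) : multilinear_form -> K :=
  fun A => sval A (fun=> x).

Definition tensor_of (z : seq (K * X)) : multilinear_form -> K :=
  fun A => \sum_(l <- z) l.1 * diag_tensor l.2 A.

Definition pi_s (t : multilinear_form -> K) : \bar R :=
  ereal_inf [set (\sum_(l <- z) rnorm (l.1 : K^o) * rnorm l.2 ^+ m)%:E
            | z in [set z : seq (K * X) | tensor_of z = t]].

Definition pi_s_cauchy (u : nat -> seq (K * X)) : Prop :=
  forall e : R, 0 < e -> exists N : nat, forall j k : nat,
    (N <= j)%N -> (N <= k)%N ->
    (pi_s (fun A => tensor_of (u j) A - tensor_of (u k) A)%R < e%:E)%E.

(* Elements of the completion are given by pi_s-Cauchy sequences of symmetric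
   tensors.  Several sequences represent the same element; this does not affect
   the topology they induce on the dual. *)
Definition completed_tensor := {u : nat -> seq (K * X) | pi_s_cauchy u}.

HB.instance Definition _ := gen_eqMixin completed_tensor.
HB.instance Definition _ := gen_choiceMixin completed_tensor.

Definition pairing0 (q : hompoly m X K^o) (z : seq (K * X)) : K^o :=
  \sum_(l <- z) l.1 * q l.2.

Lemma pairing0_tensor (q : hompoly m X K^o) (z w : seq (K * X)) :
  tensor_of z = tensor_of w -> pairing0 q z = pairing0 q w.
Proof.
have [A [mA qA]] := hompolyP q.
move=> /(congr1 (fun t => t (exist _ A mA))) eqzw.
rewrite /pairing0; under eq_bigr do rewrite qA.
by under [RHS]eq_bigr do rewrite qA.
Qed.

(* The sequence converges: |pairing0 q z| <= ||q|| * pi_s (tensor_of z). *)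
Definition pairing (q : hompoly m X K^o) (z : completed_tensor) : K^o :=
  lim ((fun n => pairing0 q (sval z n)) @ \oo).

Definition weak_star_hompoly : Type :=
  initial_topology (pairing : hompoly m X K^o -> {ptws completed_tensor -> K^o}).

HB.instance Definition _ := Topological.on weak_star_hompoly.

Definition dual_ball_set : set weak_star_hompoly :=
  [set q : hompoly m X K^o | (hompoly_norm q <= 1)%E].

Definition dual_ball : Type := set_type dual_ball_set.

HB.instance Definition _ := Topological.on dual_ball.

Definition dual_ball_val (q : dual_ball) : hompoly m X K^o := set_val q.

Lemma dual_ball0_subproof : hompoly0 m X K^o \in dual_ball_set.
Proof.
rewrite inE /dual_ball_set /= /hompoly_norm; apply: ge_ereal_sup => _ [x _ <-].
by rewrite lee_fin /rnorm /= normr0; case: (s) => /=.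
Qed.

(* The sigma-algebras generated by [g_sigma_algebraType] need a pointed type. *)
HB.instance Definition _ := isPointed.Build dual_ball
  (exist _ (hompoly0 m X K^o : weak_star_hompoly) dual_ball0_subproof).

End SymmetricTensors.

Arguments dual_ball {R s} m X.

(* [T] is meant to be Hausdorff, so that compact sets are Borel. *)
Definition regular_borel (R : realType) (T : ptopologicalType)
    (mu : set (g_sigma_algebraType (@open T)) -> \bar R) : Prop :=
  forall A : set (g_sigma_algebraType (@open T)), measurable A ->
    mu A = ereal_inf [set mu U | U in [set U : set T | open U /\ A `<=` U]] /\
    mu A = ereal_sup [set mu F | F in [set F : set T | compact F /\ F `<=` A]].

Definition factorable_strongly_summing (R : realType) (s : scalar_kind)
    (p : R) (m : nat) (X Y : normedModType (scalar_field R s))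
    (P : hompoly m X Y) : Prop :=
  exists2 C : R, 0 <= C &
  forall (m1 m2 : nat), (0 < m1)%N -> (0 < m2)%N ->
  forall (x : 'I_m1 -> 'I_m2 -> X) (lambda : 'I_m1 -> 'I_m2 -> scalar_field R s),
  (((\sum_(j < m1)
       rnorm (\sum_(i < m2) lambda j i *: P (x j i)) `^ p) `^ p^-1)%:E <=
   C%:E * ereal_sup
     [set ((\sum_(j < m1)
              rnorm (\sum_(i < m2) lambda j i *: q (x j i)) `^ p) `^ p^-1)%:E
     | q in [set q : hompoly m X (scalar_field R s)^o | (hompoly_norm q <= 1)%E]])%E.

(* Main.v *)
From HB Require Import structures.
Require Import Defs.
From mathcomp Require Import all_boot all_order all_algebra.
From mathcomp Require Import complex finmap ring lra.
From mathcomp Require Import all_classical all_reals all_analysis measurable_realfun.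

Set Implicit Arguments.
Unset Strict Implicit.
Unset Printing Implicit Defensive.

Import Order.TTheory GRing.Theory Num.Theory.
Import numFieldNormedType.Exports.

Local Open Scope classical_set_scope.
Local Open Scope ring_scope.

(** The implication from the integral inequality to the summing inequality is
    an integration.  With [f_j q] the [p]-th power of the modulus of the [j]-th
    combination at [q], the inequality gives
    [sum_j |.|^p <= C^p sum_j (int f_j)], which is [C^p] times the integral of
    [sum_j f_j] against a probability, hence at most [C^p sup_q sum_j f_j].

    The converse is Pietsch's separation argument.  Write [f_z q = |q z|^p] and
    [a_z = (|P z| / C)^p] for a tensor [z].  Since a weight [t >= 0] can be
    absorbed in the scalars of [z], the summing inequality says exactly that no
    finite combination of the functions [f_z - a_z] with nonnegative weights is
    bounded above by a negative constant ([summing_witness]).  The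
    Hahn-Banach theorem, applied to the sublinear functional [sup] on the
    bounded functions and to the cone spanned by the [f_z - a_z], yields a
    positive normalized linear functional [L] with [L f_z >= a_z]
    ([finitely_additive_integral]).

    As [L] is defined on all bounded functions, [A |-> L 1_A] is a finitely
    additive probability on all subsets of the ball.  On a compact Hausdorff
    space it has a regular Borel majorant on the closed sets
    ([content_le_regular_measure]): inner approximation by closed sets defines
    it on the open sets, outer approximation by open sets extends it to an outer
    measure, and the Caratheodory theorem makes this a measure.  The superlevel
    sets of a continuous [f >= 0] are closed, so that slicing [f] into level
    sets gives [L f <= int f dmu] ([finitely_additive_le_integral]).  Only this
    half of the Riesz representation is needed, for it already gives
    [a_z <= L f_z <= int f_z dmu].

    It remains to see that the dual ball is compact and Hausdorff.  On the ball
    the weak-star topology is that of pointwise convergence ([dual_ball_cvg]),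
    because the values at a completed tensor are uniform limits of the values at
    tensors.  An ultrafilter of polynomials in the ball converges pointwise,
    since closed disks of scalars are compact, and the limit is again a
    polynomial of the ball ([hompoly_ball_limit]): by the polarization formula
    the polar forms, which are multilinear, converge too, and the limit form is
    bounded on bounded sets, which makes its restriction to the diagonal
    continuous. *)

(** * The Hahn-Banach theorem *)

Section HahnBanach.
Context {R : realType} {V : lmodType R}.
Implicit Types (N p : V -> R) (u v : V).

(** Subadditive and positively homogeneous. *)
Definition sublinear N :=
  (forall u v, N (u + v) <= N u + N v) /\
  (forall (t : R) v, 0 <= t -> N (t *: v) = t * N v).

Lemma sublinear0 N : sublinear N -> N 0 = 0.
Proof. by case=> _ hN; rewrite -[X in N X](scale0r (0 : V)) hN// mul0r. Qed.

Lemma sublinear_oppr N v : sublinear N -> - N (- v) <= N v.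
Proof.
move=> sN; have := sN.1 v (- v); rewrite subrr sublinear0// => h.
by rewrite lerNl -subr_ge0 opprK addrC.
Qed.

Lemma sublinear_le_oppr N p v :
  sublinear N -> (forall u, N u <= p u) -> - p (- v) <= N v.
Proof.
move=> sN Np; apply: le_trans (sublinear_oppr v sN).
by rewrite lerN2.
Qed.

(** The lower bound required by Zorn's lemma.  The infimum of a chain is finite
    because every sublinear [N <= p] satisfies [- p (- v) <= N v]. *)
Lemma sublinear_chain_inf p (C : set (V -> R)) : C !=set0 ->
  (forall N, C N -> sublinear N /\ forall v, N v <= p v) ->
  (forall N1 N2, C N1 -> C N2 ->
     (forall v, N1 v <= N2 v) \/ (forall v, N2 v <= N1 v)) ->
  let I := fun v => inf [set N v | N in C] in
  [/\ sublinear I, (forall v, I v <= p v) & forall N v, C N -> I v <= N v].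
Proof.
move=> [N0 CN0] Cp Ctot I.
have lbC v : has_lbound [set N v | N in C].
  exists (- p (- v)) => _ [N /Cp[sN Np] <-]; exact: sublinear_le_oppr.
have infC v : has_inf [set N v | N in C] by split=> //; exists (N0 v), N0.
have ICle N v : C N -> I v <= N v by move=> CN; apply: ge_inf => //; exists N.
have Ile v x : (forall N, C N -> x <= N v) -> x <= I v.
  by move=> h; apply: lb_le_inf; [exact: (infC v).1|move=> _ [N CN <-]; exact: h].
split=> //; last first.
  by move=> v; apply: (le_trans (ICle N0 v CN0)); exact: (Cp _ CN0).2.
split.
  move=> u v; apply/ler_addgt0Pr => e e0.
  have e20 : 0 < e / 2 by rewrite divr_gt0.
  have [_ [N1 CN1 <-] h1] := inf_adherent e20 (infC u).
  have [_ [N2 CN2 <-] h2] := inf_adherent e20 (infC v).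
  rewrite -/(I u) in h1; rewrite -/(I v) in h2.
  have [N CN [le1 le2]] : exists2 N, C N & N u <= N1 u /\ N v <= N2 v.
    by have [h|h] := Ctot _ _ CN1 CN2; [exists N1|exists N2].
  apply: (le_trans (ICle N _ CN)); apply: (le_trans ((Cp _ CN).1.1 u v)).
  by lra.
move=> t v; rewrite le_eqVlt => /predU1P[<-|t0].
  rewrite scale0r mul0r; apply/eqP; rewrite eq_le; apply/andP; split.
    by rewrite (le_trans (ICle N0 _ CN0))// sublinear0//; exact: (Cp _ CN0).1.
  by apply: Ile => N /Cp[sN _]; rewrite sublinear0.
apply/eqP; rewrite eq_le; apply/andP; split.
  rewrite mulrC -ler_pdivrMr//; apply: Ile => N CN; rewrite ler_pdivrMr//.
  by apply: (le_trans (ICle N _ CN)); rewrite (Cp _ CN).1.2 ?(ltW t0)// mulrC.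
apply: Ile => N CN; rewrite (Cp _ CN).1.2 ?(ltW t0)// ler_pM2l//; exact: ICle.
Qed.

(** A sublinear functional that is minimal among the sublinear ones is odd:
    otherwise it could be lowered in the direction of [g] by the functional
    [v |-> inf_(t >= 0) (N (v + t g) - t N g)]. *)
Lemma minimal_sublinear_odd N g : sublinear N ->
  (forall N', sublinear N' -> (forall v, N' v <= N v) ->
     forall v, N v <= N' v) ->
  N (- g) = - N g.
Proof.
move=> sN minN.
pose E v := [set N (v + t *: g) - t * N g | t in [set t : R | 0 <= t]].
pose I v := inf (E v).
have lbE v : lbound (E v) (- N (- v)).
  move=> _ [t /= t0 <-]; rewrite -sN.2//.
  have := sN.1 (v + t *: g) (- v); rewrite addrAC subrr add0r; lra.
have infE v : has_inf (E v).
  by split; [exists (N (v + 0 *: g) - 0 * N g), 0; rewrite /=|exists (- N (- v))].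
have Ile v t : 0 <= t -> I v <= N (v + t *: g) - t * N g.
  by move=> t0; apply: ge_inf; [exact: (infE v).2|exists t].
have leI v x : (forall t, 0 <= t -> x <= N (v + t *: g) - t * N g) -> x <= I v.
  by move=> h; apply: lb_le_inf; [exact: (infE v).1|move=> _ [t /= t0 <-]; exact: h].
have IN v : I v <= N v by have := Ile v 0 (lexx 0); rewrite scale0r mul0r addr0 subr0.
have sI : sublinear I.
  split.
    move=> u v; apply/ler_addgt0Pr => e e0.
    have e20 : 0 < e / 2 by rewrite divr_gt0.
    have [_ [t1 /= t10 <-] h1] := inf_adherent e20 (infE u).
    have [_ [t2 /= t20 <-] h2] := inf_adherent e20 (infE v).
    rewrite -/(I u) in h1; rewrite -/(I v) in h2.
    apply: (le_trans (Ile (u + v) (t1 + t2) (addr_ge0 t10 t20))).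
    have := sN.1 (u + t1 *: g) (v + t2 *: g).
    rewrite addrACA -scalerDl => h; lra.
  move=> t v; rewrite le_eqVlt => /predU1P[<-|t0].
    rewrite scale0r mul0r; apply/eqP; rewrite eq_le; apply/andP; split.
      by rewrite (le_trans (IN 0))// sublinear0.
    by apply: leI => r r0; rewrite add0r sN.2// subrr.
  apply/eqP; rewrite eq_le; apply/andP; split.
    rewrite mulrC -ler_pdivrMr//; apply: leI => r r0; rewrite ler_pdivrMr//.
    have tr0 : 0 <= t * r by rewrite mulr_ge0// ltW.
    apply: (le_trans (Ile (t *: v) _ tr0)).
    by rewrite -scalerA -scalerDr sN.2 ?(ltW t0)// [leRHS]mulrC mulrBr mulrA.
  apply: leI => r r0; rewrite mulrC -ler_pdivlMr//.
  have rt0 : 0 <= r / t by rewrite divr_ge0// ltW.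
  apply: (le_trans (Ile v _ rt0)); rewrite ler_pdivlMr// mulrBl.
  rewrite [X in X - _]mulrC -sN.2 ?(ltW t0)// scalerDr scalerA.
  by rewrite mulrCA divff ?gt_eqF// mulr1 mulrAC divfK ?gt_eqF.
have IoN := minN I sI IN (- g).
apply/eqP; rewrite eq_le; apply/andP; split.
  apply: (le_trans IoN); have := Ile (- g) 1 ler01.
  by rewrite scale1r addNr sublinear0// mul1r sub0r.
by rewrite lerNl; exact: sublinear_oppr.
Qed.

(** A minimal sublinear functional below [p] is odd, hence linear. *)
Theorem hahn_banach p : sublinear p ->
  exists2 L : V -> R, scalar L & forall v, L v <= p v.
Proof.
move=> sp.
pose S := {N : V -> R | sublinear N /\ forall v, N v <= p v}.
pose p0 : S := exist _ p (conj sp (fun v => lexx (p v))).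
pose le (N1 N2 : S) : bool := `[< forall v, sval N2 v <= sval N1 v >].
have [||A totA|[N [sN Np]] maxN] := @ZL_preorder S p0 le.
- by move=> N; apply/asboolP.
- move=> N1 N2 N3 /asboolP h1 /asboolP h2; apply/asboolP => v.
  exact: le_trans (h1 v).
- have [[N0 AN0]|A0] := pselect (A !=set0); last first.
    by exists p0 => N AN; exfalso; apply: A0; exists N.
  have [|||sI Ip IN] := @sublinear_chain_inf p [set sval N | N in A].
  + by exists (sval N0), N0.
  + by move=> _ [N AN <-]; exact: svalP N.
  + move=> _ _ [N1 AN1 <-] [N2 AN2 <-].
    by have [/asboolP h|/asboolP h] := totA _ _ AN1 AN2; [right|left].
  exists (exist (fun N => sublinear N /\ forall v, N v <= p v) _ (conj sI Ip)).
  move=> N AN; apply/asboolP => v.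
  by apply: IN; exists N.
exists N => // ; have odd g : N (- g) = - N g.
  apply: minimal_sublinear_odd => // N' sN' N'N.
  have N'p v : N' v <= p v by apply: (le_trans (N'N v)).
  by have /asboolP := maxN (exist (fun N => sublinear N /\ forall v, N v <= p v) N'
    (conj sN' N'p)) (asboolT N'N).
have addN u v : N (u + v) = N u + N v.
  apply/eqP; rewrite eq_le sN.1/=.
  have := sN.1 (u + v) (- v); rewrite addrK odd; lra.
move=> t u v; rewrite addN; congr (_ + _).
have [t0|t0] := leP 0 t; first by rewrite sN.2.
rewrite -[t in LHS]opprK scaleNr odd sN.2; last by rewrite oppr_ge0 ltW.
by rewrite mulNr opprK.
Qed.

End HahnBanach.

Section HahnBanachCone.
Context {R : realType} {V : lmodType R}.
Implicit Types (u v : V).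

(** For a sublinear [S] and a convex cone [H], the linear functionals that
    [cone_gauge S H] dominates are those that [S] dominates and that are
    nonnegative on [H]. *)
Definition cone_gauge (S : V -> R) (H : set V) (v : V) : R :=
  inf [set S (v + h) | h in H].

Theorem hahn_banach_cone (S : V -> R) (H : set V) : sublinear S ->
  H 0 -> (forall u v, H u -> H v -> H (u + v)) ->
  (forall (t : R) v, 0 <= t -> H v -> H (t *: v)) ->
  (forall h, H h -> 0 <= S h) ->
  exists L : V -> R,
    [/\ scalar L, forall v, L v <= S v & forall h, H h -> 0 <= L h].
Proof.
move=> sS H0 HD HZ HS; pose p := cone_gauge S H.
have infp v : has_inf [set S (v + h) | h in H].
  split; first by exists (S (v + 0)), 0.
  exists (- S (- v)) => _ [h Hh <-].
  by have := sS.1 (v + h) (- v); rewrite addrAC subrr add0r; have := HS h Hh; lra.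
have ple v h : H h -> p v <= S (v + h).
  by move=> Hh; apply: ge_inf; [exact: (infp v).2|exists h].
have lep v x : (forall h, H h -> x <= S (v + h)) -> x <= p v.
  by move=> h; apply: lb_le_inf; [exact: (infp v).1|move=> _ [k Hk <-]; exact: h].
have pS v : p v <= S v by rewrite -[in leRHS](addr0 v); exact: ple.
have p0 : p 0 = 0.
  apply/eqP; rewrite eq_le -{1}(sublinear0 sS) pS/=.
  by apply: lep => h Hh; rewrite add0r; exact: HS.
have sp : sublinear p.
  split.
    move=> u v; apply/ler_addgt0Pr => e e0.
    have e20 : 0 < e / 2 by rewrite divr_gt0.
    have [_ [h Hh <-] h1] := inf_adherent e20 (infp u).
    have [_ [k Hk <-] h2] := inf_adherent e20 (infp v).
    rewrite -/(cone_gauge S H u) -/(p u) in h1.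
    rewrite -/(cone_gauge S H v) -/(p v) in h2.
    apply: (le_trans (ple (u + v) (h + k) (HD _ _ Hh Hk))).
    have := sS.1 (u + h) (v + k); rewrite addrACA; lra.
  move=> t v; rewrite le_eqVlt => /predU1P[<-|t0].
    by rewrite scale0r mul0r.
  apply/eqP; rewrite eq_le; apply/andP; split.
    rewrite mulrC -ler_pdivrMr//; apply: lep => h Hh; rewrite ler_pdivrMr//.
    apply: (le_trans (ple (t *: v) (t *: h) (HZ _ _ (ltW t0) Hh))).
    by rewrite -scalerDr sS.2 ?(ltW t0)// mulrC.
  apply: lep => h Hh; rewrite mulrC -ler_pdivlMr//.
  have ti0 : 0 <= t^-1 by rewrite invr_ge0 ltW.
  apply: (le_trans (ple v (t^-1 *: h) (HZ _ _ ti0 Hh))).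
  rewrite -[v in leLHS](scalerK (lt0r_neq0 t0)) -scalerDr sS.2//.
  by rewrite mulrC.
have [L linL Lp] := hahn_banach sp.
exists L; split=> //; first by move=> v; exact: le_trans (Lp v) (pS v).
have LN v : L (- v) = - L v.
  have L0 : L 0 = 0 by have := linL 1 0 0; rewrite scaler0 addr0 mul1r; lra.
  by have := linL (-1) v 0; rewrite L0 !addr0 scaleN1r mulN1r.
move=> h Hh; rewrite -oppr_le0 -LN; apply: (le_trans (Lp (- h))).
by apply: (le_trans (ple (- h) h Hh)); rewrite addNr sublinear0.
Qed.

End HahnBanachCone.

(** * Finitely additive integration of bounded functions *)

Section BoundedFunctions.
Context {R : realType} (T : pointedType).

(** Bounded real functions. *)
Definition fbounded (f : T -> R) := exists M : R, forall x, `|f x| <= M.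

Lemma fbounded_cst (c : R) : fbounded (fun=> c).
Proof. by exists `|c|. Qed.

Lemma fboundedD f g : fbounded f -> fbounded g -> fbounded (f \+ g).
Proof.
move=> [M fM] [N gN]; exists (M + N) => x.
by rewrite (le_trans (ler_normD _ _))// lerD.
Qed.

Lemma fboundedZ (c : R) f : fbounded f -> fbounded (c \*o f).
Proof. by move=> [M fM]; exists (`|c| * M) => x; rewrite normrM ler_wpM2l. Qed.

Lemma fbounded_sum I (r : seq I) (f : I -> T -> R) :
  (forall i, fbounded (f i)) -> fbounded (fun x => \sum_(i <- r) f i x).
Proof.
move=> bf; elim: r => [|i r ih].
  by under eq_fun do rewrite big_nil; exact: fbounded_cst.
by under eq_fun do rewrite big_cons; exact: fboundedD.
Qed.

Lemma fbounded_indic (A : set T) : fbounded (\1_A).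
Proof. by exists 1 => x; rewrite indicE; case: (x \in A); rewrite ?normr1 ?normr0. Qed.

Definition fbounded_pred : {pred T -> R} := fun f => `[< fbounded f >].

Lemma fbounded_submod : submod_closed fbounded_pred.
Proof.
split; first by apply/asboolP; exact: fbounded_cst.
move=> a f g /asboolP bf /asboolP bg; apply/asboolP.
exact: (fboundedD (fboundedZ a bf) bg).
Qed.

HB.instance Definition _ :=
  GRing.isSubmodClosed.Build R (T -> R) fbounded_pred fbounded_submod.

(** The vector space of bounded functions, as a subtype of all functions. *)
Record bfun := BFun { bfun_val :> T -> R; _ : bfun_val \in fbounded_pred }.
HB.instance Definition _ := [isSub for bfun_val].
HB.instance Definition _ := [Choice of bfun by <:].
HB.instance Definition _ := [SubChoice_isSubLmodule of bfun by <:].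

Lemma bfunP (f : bfun) : fbounded f.
Proof. by case: f => f /= /asboolP. Qed.

(** The supremum, a sublinear functional: the linear functionals it dominates
    are the positive ones that map the constant 1 to 1. *)
Definition bfun_sup (f : bfun) : R := sup (range f).

Lemma has_sup_bfun (f : bfun) : has_sup (range f).
Proof.
split; first by exists (f point), point.
have [M fM] := bfunP f; exists M => _ [x _ <-].
exact: le_trans (ler_norm _) (fM x).
Qed.

Lemma bfun_sup_ge (f : bfun) x : f x <= bfun_sup f.
Proof. by apply: ub_le_sup; [exact: (has_sup_bfun f).2|exists x]. Qed.

Lemma bfun_sup_le (f : bfun) r : (forall x, f x <= r) -> bfun_sup f <= r.
Proof.
move=> h; apply: ge_sup; first exact: (has_sup_bfun f).1.
by move=> _ [x _ <-].
Qed.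

Lemma sublinear_bfun_sup : sublinear bfun_sup.
Proof.
split=> [f g|t f t_ge0].
  by apply: bfun_sup_le => x; rewrite lerD// bfun_sup_ge.
apply/eqP; rewrite eq_le; apply/andP; split.
  by apply: bfun_sup_le => x; rewrite ler_wpM2l// bfun_sup_ge.
move: t_ge0; rewrite [0 <= t]le_eqVlt => /predU1P[<-|t0].
  by rewrite mul0r (le_trans _ (bfun_sup_ge _ point))//= scale0r.
rewrite mulrC -ler_pdivlMr//; apply: bfun_sup_le => x.
rewrite ler_pdivlMr// mulrC; exact: (bfun_sup_ge (t *: f)).
Qed.

Definition bfun_of f (bf : fbounded f) : bfun := BFun (asboolT bf).

(** Finitely additive integration: a functional [L] as below is the integral
    with respect to the finitely additive probability [A |-> L \1_A].  One exists
    that is nonnegative on a given convex cone of functions as soon as no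
    function of the cone is bounded above by a negative constant. *)
Theorem finitely_additive_integral (H : set (T -> R)) :
  H !=set0 ->
  (forall h, H h -> fbounded h) ->
  (forall g h, H g -> H h -> H (g \+ h)) ->
  (forall (t : R) h, 0 <= t -> H h -> H (t \*o h)) ->
  (forall h (e : R), H h -> 0 < e -> exists x, - e <= h x) ->
  exists L : (T -> R) -> R,
  [/\ forall f g, fbounded f -> fbounded g -> L (f \+ g) = L f + L g,
      forall (c : R) f, fbounded f -> L (c \*o f) = c * L f,
      forall f g, fbounded f -> fbounded g -> (forall x, f x <= g x) -> L f <= L g,
      L (fun=> 1) = 1 &
      forall h, H h -> 0 <= L h].
Proof.
move=> [h0 Hh0] bH HD HZ Hsup.
have [||||L [linL LS LH]] := hahn_banach_cone (H := [set h : bfun | H h]) sublinear_bfun_sup.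
- rewrite /mkset; suff -> : bfun_val (0 : bfun) = 0 \*o h0 by exact: HZ.
  by apply/funext => x /=; rewrite mul0r.
- by move=> u v; exact: HD.
- by move=> t v; exact: HZ.
- move=> h Hh; apply/ler_addgt0Pr => e e0; have [x hx] := Hsup _ _ Hh e0.
  by rewrite -lerBlDr sub0r (le_trans hx)// bfun_sup_ge.
have linE (c : R) (f g : bfun) : L (c *: f + g) = c * L f + L g by exact: linL.
have L0 : L 0 = 0 by have := linE 1 0 0; rewrite scaler0 addr0 mul1r; lra.
have LD f g : L (f + g) = L f + L g by rewrite -[f]scale1r linE scale1r mul1r.
have LZ (c : R) f : L (c *: f) = c * L f by rewrite -[c *: f]addr0 linE L0 addr0.
(* [L] is extended by zero to the unbounded functions. *)
pose K (f : T -> R) := if pselect (fbounded f) is left bf then L (bfun_of bf) else 0.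
have KE f (g : bfun) : f = g :> (T -> R) -> K f = L g.
  move=> fg; rewrite /K; case: pselect => [bf|[]]; last first.
    by rewrite fg; exact: bfunP.
  by congr L; exact: val_inj.
exists K; split.
- move=> f g bf bg.
  rewrite (KE f (bfun_of bf))// (KE g (bfun_of bg))// -LD.
  exact: KE.
- by move=> c f bf; rewrite (KE f (bfun_of bf))// -LZ; exact: KE.
- move=> f g bf bg fg; rewrite (KE f (bfun_of bf))// (KE g (bfun_of bg))//.
  have : L (bfun_of bf + -1 *: bfun_of bg) <= 0.
    apply: (le_trans (LS _)); apply: bfun_sup_le => x.
    by change (f x + -1 * g x <= 0); rewrite mulN1r subr_le0.
  by rewrite LD LZ; lra.
- rewrite (KE _ (bfun_of (fbounded_cst 1)))//.
  apply/eqP; rewrite eq_le (le_trans (LS _)) /=; last exact: bfun_sup_le.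
  have : L (-1 *: bfun_of (fbounded_cst 1)) <= - 1.
    apply: (le_trans (LS _)); apply: bfun_sup_le => x.
    by change (-1 * 1 <= -1 :> R); rewrite mulr1.
  by rewrite LZ; lra.
- by move=> h Hh; rewrite (KE h (bfun_of (bH _ Hh)))//; exact: LH.
Qed.

End BoundedFunctions.

(** * From a finitely additive probability to a regular Borel measure *)

Section RegularMeasureOfContent.
Context {R : realType} {T : ptopologicalType}.
Hypothesis hausT : hausdorff_space T.
Hypothesis cptT : compact [set: T].
Variable m : set T -> R.
Hypothesis m_ge0 : forall A, 0 <= m A.
Hypothesis mU : forall A B, A `&` B = set0 -> m (A `|` B) = m A + m B.
Hypothesis mT : m setT = 1.
Implicit Types A B F U V : set T.

Lemma content0 : m set0 = 0.
Proof. by have := mU (setI0 set0); rewrite setU0 => h; lra. Qed.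

Lemma content_le A B : A `<=` B -> m A <= m B.
Proof.
move=> AB; rewrite -(setDUK AB) mU ?lerDl//.
by rewrite setDE setIC -setIA [~` A `&` A]setIC setICr setI0.
Qed.

Lemma contentU_le A B : m (A `|` B) <= m A + m B.
Proof.
have -> : A `|` B = A `|` (B `\` A).
  apply/seteqP; split=> x; last by case=> [|[]]; [left|right].
  by case=> h; [left|have [|] := pselect (A x); [left|right]].
rewrite mU; last by rewrite setDE setIC -setIA [~` A `&` A]setIC setICr setI0.
by rewrite lerD2l content_le//; exact: subDsetl.
Qed.

(** The size of an open set [U], approximated from inside by closed sets. *)
Definition inner_content U : R := sup [set m F | F in [set F | closed F /\ F `<=` U]].

(** The size of an arbitrary set, approximated from outside by open sets. *)
Definition outer_content A : R :=
  inf [set inner_content U | U in [set U | open U /\ A `<=` U]].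

Lemma has_sup_inner U : has_sup [set m F | F in [set F | closed F /\ F `<=` U]].
Proof.
split; first by exists (m set0), set0 => //; split=> //; exact: closed0.
by exists 1 => _ [F _ <-]; rewrite -mT content_le.
Qed.

Lemma inner_content_ge F U : closed F -> F `<=` U -> m F <= inner_content U.
Proof.
by move=> cF FU; apply: ub_le_sup; [exact: (has_sup_inner U).2|exists F].
Qed.

Lemma inner_content_adherent U (e : R) : 0 < e ->
  exists F, [/\ closed F, F `<=` U & inner_content U < m F + e].
Proof.
move=> e0; have [_ [F [cF FU] <-] h] := sup_adherent e0 (has_sup_inner U).
by exists F; split=> //; rewrite -ltrBlDr.
Qed.

Lemma inner_content_leP U (r : R) :
  (forall F, closed F -> F `<=` U -> m F <= r) -> inner_content U <= r.
Proof.
move=> h; apply: ge_sup; first exact: (has_sup_inner U).1.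
by move=> _ [F [cF FU] <-]; exact: h.
Qed.

Lemma inner_content_mono U V : U `<=` V -> inner_content U <= inner_content V.
Proof.
move=> UV; apply: inner_content_leP => F cF FU; apply: inner_content_ge => //.
exact: subset_trans UV.
Qed.

Lemma inner_content_ge0 U : 0 <= inner_content U.
Proof.
by rewrite -content0; apply: inner_content_ge; [exact: closed0|exact: sub0set].
Qed.

Lemma inner_content0 : inner_content set0 = 0.
Proof.
apply/eqP; rewrite eq_le inner_content_ge0 andbT.
by apply: inner_content_leP => F _; rewrite subset0 => ->; rewrite content0.
Qed.

Lemma inner_contentT : inner_content setT = 1.
Proof.
apply/eqP; rewrite eq_le; apply/andP; split.
  by apply: inner_content_leP => F _ _; rewrite -mT content_le.
by rewrite -mT; apply: inner_content_ge => //; exact: closedT.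
Qed.

(** A closed set covered by two open sets splits into two closed sets, one
    inside each of them: this is where normality enters. *)
Lemma closed_split F U V : closed F -> open U -> open V -> F `<=` U `|` V ->
  exists A B, [/\ closed A, closed B, A `<=` U, B `<=` V & F `<=` A `|` B].
Proof.
move=> cF oU oV FUV.
have /(@normal_openP R)/(_ (F `\` U) (F `\` V)) := compact_normal hausT cptT.
case.
- by apply: closedI => //; exact: open_closedC.
- by apply: closedI => //; exact: open_closedC.
- apply/seteqP; split=> // x [[Fx nUx] [_ nVx]].
  by case: (FUV x Fx).
move=> W1 [W2 [oW1 oW2 s1 s2 W12]].
exists (F `\` W1), (F `\` W2); split.
- by apply: closedI => //; exact: open_closedC.
- by apply: closedI => //; exact: open_closedC.
- by move=> x [Fx nW1]; apply: contrapT => nUx; apply: nW1; apply: s1.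
- by move=> x [Fx nW2]; apply: contrapT => nVx; apply: nW2; apply: s2.
- move=> x Fx; have [W1x|] := pselect (W1 x); last by left.
  right; split=> // W2x; have : (W1 `&` W2) x by [].
  by rewrite W12.
Qed.

Lemma inner_contentU U V : open U -> open V ->
  inner_content (U `|` V) <= inner_content U + inner_content V.
Proof.
move=> oU oV; apply: inner_content_leP => F cF FUV.
have [A [B [cA cB AU BV FAB]]] := closed_split cF oU oV FUV.
apply: (le_trans (content_le FAB)); apply: (le_trans (contentU_le A B)).
by apply: lerD; exact: inner_content_ge.
Qed.

Lemma inner_content_bigcup_ord (U : nat -> set T) n : (forall i, open (U i)) ->
  inner_content (\bigcup_(i in `I_n) U i) <= \sum_(i < n) inner_content (U i).
Proof.
move=> oU; elim: n => [|n ih].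
  by rewrite II0 bigcup_set0 inner_content0 big_ord0.
rewrite IIS bigcup_setU bigcup_set1 big_ord_recr/=.
apply: (le_trans (inner_contentU _ (oU n))); first exact: bigcup_open.
by rewrite lerD2r.
Qed.

(** Countable subadditivity on open sets: a closed subset of the union is
    compact, so it lies in a finite union. *)
Lemma inner_content_bigcup (U : nat -> set T) : (forall i, open (U i)) ->
  ((inner_content (\bigcup_i U i))%:E <= \sum_(i <oo) (inner_content (U i))%:E)%E.
Proof.
move=> oU; apply/lee_addgt0Pr => e e0.
have [F [cF FU Fe]] := inner_content_adherent (\bigcup_i U i) e0.
have : compact F by exact: subclosed_compact cptT _.
rewrite compact_cover => /(_ nat setT U (fun i _ => oU i) FU)[D _ FD].
pose n := (\max_(i <- enum_fset D) i).+1.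
have Fn : F `<=` \bigcup_(i in `I_n) U i.
  move=> x /FD[i /= iD Uix]; exists i => //=.
  by rewrite /n ltnS; apply: (@leq_bigmax_seq _ _ xpredT id).
apply: (@le_trans _ _ ((m F)%:E + e%:E)%E).
  by rewrite -EFinD lee_fin ltW.
rewrite leeD2r//.
apply: (@le_trans _ _ (\sum_(0 <= i < n) (inner_content (U i))%:E)%E); last first.
  by apply: nneseries_lim_ge => i _; rewrite lee_fin inner_content_ge0.
rewrite sumEFin lee_fin big_mkord.
apply: le_trans (inner_content_bigcup_ord n oU).
exact: inner_content_ge.
Qed.

Lemma has_inf_outer A :
  has_inf [set inner_content U | U in [set U | open U /\ A `<=` U]].
Proof.
split; first by exists (inner_content setT), setT => //; split=> //; exact: openT.
by exists 0 => _ [U _ <-]; exact: inner_content_ge0.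
Qed.

Lemma outer_content_le A U : open U -> A `<=` U ->
  outer_content A <= inner_content U.
Proof.
by move=> oU AU; apply: ge_inf; [exact: (has_inf_outer A).2|exists U].
Qed.

Lemma outer_content_geP A (r : R) :
  (forall U, open U -> A `<=` U -> r <= inner_content U) -> r <= outer_content A.
Proof.
move=> h; apply: lb_le_inf; first exact: (has_inf_outer A).1.
by move=> _ [U [oU AU] <-]; exact: h.
Qed.

Lemma outer_content_adherent A (e : R) : 0 < e ->
  exists U, [/\ open U, A `<=` U & inner_content U < outer_content A + e].
Proof.
move=> e0; have [_ [U [oU AU] <-] h] := inf_adherent e0 (has_inf_outer A).
by exists U.
Qed.

Lemma outer_content_mono A B : A `<=` B -> outer_content A <= outer_content B.
Proof.
move=> AB; apply: outer_content_geP => U oU BU; apply: outer_content_le => //.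
exact: subset_trans BU.
Qed.

Lemma outer_content_ge0 A : 0 <= outer_content A.
Proof. by apply: outer_content_geP => U _ _; exact: inner_content_ge0. Qed.

Lemma outer_content_open U : open U -> outer_content U = inner_content U.
Proof.
move=> oU; apply/eqP; rewrite eq_le outer_content_le//=.
by apply: outer_content_geP => V _; exact: inner_content_mono.
Qed.

Lemma content_le_outer F : closed F -> m F <= outer_content F.
Proof. by move=> cF; apply: outer_content_geP => U _; exact: inner_content_ge. Qed.

(** [outer_content] with extended real values, as outer measures have them. *)
Definition outer_of_content A : \bar R := (outer_content A)%:E.

Lemma outer_of_content0 : outer_of_content set0 = 0%E.
Proof.
rewrite /outer_of_content outer_content_open ?inner_content0//; exact: open0.
Qed.

Lemma outer_of_content_ge0 A : (0 <= outer_of_content A)%E.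
Proof. by rewrite lee_fin outer_content_ge0. Qed.

Lemma le_outer_of_content :
  {homo outer_of_content : A B / A `<=` B >-> (A <= B)%E}.
Proof. by move=> A B AB; rewrite lee_fin outer_content_mono. Qed.

Lemma outer_of_content_sigma_subadditive : sigma_subadditive outer_of_content.
Proof.
move=> A; apply/lee_addgt0Pr => e e0.
have eps0 n : 0 < e / (2 ^ n.+1)%:R by rewrite divr_gt0// ltr0n expn_gt0.
have [U hU] := choice (fun n => outer_content_adherent (A n) (eps0 n)).
have oU n : open (U n) by have [] := hU n.
apply: le_trans (epsilon_trick _ _ (ltW e0)); last first.
  by move=> n; exact: outer_of_content_ge0.
apply: (@le_trans _ _ (inner_content (\bigcup_n U n))%:E).
  rewrite lee_fin outer_content_le//; first exact: bigcup_open.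
  by apply: subset_bigcup => n _; have [] := hU n.
apply: (le_trans (inner_content_bigcup oU)).
apply: lee_nneseries => n _; first by rewrite lee_fin inner_content_ge0.
by rewrite -EFinD lee_fin ltW//; have [] := hU n.
Qed.

HB.instance Definition _ := isOuterMeasure.Build R T outer_of_content
  outer_of_content0 outer_of_content_ge0 le_outer_of_content
  outer_of_content_sigma_subadditive.

Lemma open_caratheodory U : open U -> outer_of_content.-caratheodory U.
Proof.
move=> oU; apply: le_caratheodory_measurable => A.
rewrite -EFinD lee_fin; apply: outer_content_geP => V oV AV.
have oVU : open (V `&` U) by exact: openI.
apply: (@le_trans _ _ (outer_content (V `&` U) + outer_content (V `&` ~` U))).
  by apply: lerD; apply: outer_content_mono; exact: setSI.
rewrite (outer_content_open oVU).
apply/ler_addgt0Pr => e e0.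
have e20 : 0 < e / 2 by rewrite divr_gt0.
have [F [cF FVU Fe]] := inner_content_adherent (V `&` U) e20.
have oVF : open (V `&` ~` F) by apply: openI => //; exact: closed_openC.
(* [F] almost exhausts [V] inside [U], and [G] almost exhausts the rest. *)
have [G [cG GVF Ge]] := inner_content_adherent (V `&` ~` F) e20.
have : outer_content (V `&` ~` U) <= inner_content (V `&` ~` F).
  apply: outer_content_le => // x [Vx nUx]; split=> // Fx.
  by apply: nUx; have [] := FVU x Fx.
have : m (F `|` G) <= inner_content V.
  apply: inner_content_ge; first exact: closedU.
  by move=> x [/FVU[]//|/GVF[]].
rewrite mU; last first.
  by apply/seteqP; split=> // x [Fx /GVF[_]].
by lra.
Qed.

Lemma borel_caratheodory A :
  <<s @open T >> A -> outer_of_content.-caratheodory A.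
Proof.
apply: smallest_sub => //; last by move=> U; exact: open_caratheodory.
split.
- exact: caratheodory_measurable_set0.
- by move=> B hB; rewrite setTD; exact: caratheodory_measurable_setC.
- exact: caratheodory_measurable_bigcup.
Qed.

(** The restriction of the outer measure to the Borel sets. *)
Definition measure_of_content (A : set (g_sigma_algebraType (@open T))) : \bar R :=
  outer_of_content A.

Lemma measure_of_content_sigma_additive : semi_sigma_additive measure_of_content.
Proof.
move=> A mA tA mcupA.
apply: (@caratheodory_measure_sigma_additive R T outer_of_content A) => //.
- by move=> i; exact: borel_caratheodory (mA i).
- exact: borel_caratheodory mcupA.
Qed.

HB.instance Definition _ := isMeasure.Build _ _ _ measure_of_content
  outer_of_content0 outer_of_content_ge0 measure_of_content_sigma_additive.

Lemma measure_of_contentT : measure_of_content setT = 1%E.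
Proof.
rewrite /measure_of_content /outer_of_content outer_content_open ?inner_contentT//.
exact: openT.
Qed.

HB.instance Definition _ :=
  Measure_isProbability.Build _ _ _ measure_of_content measure_of_contentT.

Lemma open_borel U : open U -> measurable (U : set (g_sigma_algebraType (@open T))).
Proof. by move=> oU; exact: sub_sigma_algebra. Qed.

Lemma regular_measure_of_content : regular_borel measure_of_content.
Proof.
move=> A mA; split; apply/eqP; rewrite eq_le; apply/andP; split.
- apply: le_ereal_inf_tmp => _ [U [oU AU] <-].
  by rewrite lee_fin; exact: outer_content_mono.
- apply/lee_addgt0Pr => e e0.
  have [U [oU AU Ue]] := outer_content_adherent A e0.
  apply: (@le_trans _ _ (measure_of_content U)).
    by apply: ereal_inf_lbound; exists U.
  by rewrite -EFinD lee_fin outer_content_open// ltW.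
- apply/lee_addgt0Pr => e e0.
  have [U [oU AU Ue]] := outer_content_adherent (~` A) e0.
  have cU : closed (~` U) by exact: open_closedC.
  apply: (@le_trans _ _ (measure_of_content (~` U) + e%:E)%E); last first.
    rewrite leeD2r//; apply: ereal_sup_ubound; exists (~` U) => //; split.
      exact: subclosed_compact cptT _.
    by move=> x nUx; apply: contrapT => nAx; apply: nUx; exact: AU.
  have hC B : measurable (B : set (g_sigma_algebraType (@open T))) ->
      outer_content B + outer_content (~` B) = 1.
    move=> mB; have := borel_caratheodory mB setT.
    by rewrite !setTI -EFinD {1}/outer_of_content outer_content_open
      ?inner_contentT; [case|exact: openT].
  (* The mass 1 of the space turns the outer approximation of the complement
     into an inner approximation by compact sets. *)
  have := hC _ mA; have := hC _ (open_borel oU).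
  rewrite (outer_content_open oU) -EFinD lee_fin => h1 h2; lra.
- apply: ge_ereal_sup => _ [F [_ FA] <-].
  by rewrite lee_fin; exact: outer_content_mono.
Qed.

Theorem content_le_regular_measure :
  exists mu : probability (g_sigma_algebraType (@open T)) R,
    regular_borel mu /\ forall F, closed F -> ((m F)%:E <= mu F)%E.
Proof.
exists measure_of_content; split; first exact: regular_measure_of_content.
by move=> F cF; rewrite lee_fin; exact: content_le_outer.
Qed.

End RegularMeasureOfContent.

(** * Domination of a finitely additive integral by a Borel integral *)

Section LevelSets.
Context {R : realType} {T : ptopologicalType}.

Lemma continuous_measurable_borel (f : T -> R) : continuous f ->
  measurable_fun setT (f : g_sigma_algebraType (@open T) -> R).
Proof.
move=> cf; apply: (measurability _ (RGenOpens.measurableE R)).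
move=> _ [_ [x [y ->]] <-]; rewrite setTI; apply: sub_sigma_algebra.
by apply: open_comp => [z _|]; [exact: cf|exact: interval_open].
Qed.

Lemma compact_fbounded (f : T -> R) : compact [set: T] -> continuous f -> fbounded f.
Proof.
move=> cT cf.
have : compact (f @` setT) by apply: continuous_compact => //; exact: continuous_subspaceT.
move=> /compact_bounded[M [_ hM]]; exists (M + 1) => x.
by apply: hM; [rewrite ltrDl|exists x].
Qed.

(** For [f >= 0] and [e > 0], [level_sum f e n x] is the largest [k e <= f x]
    with [k <= n], written as a combination of indicators of superlevel sets. *)
Definition level_sum (f : T -> R) (e : R) (n : nat) (x : T) : R :=
  \sum_(k < n) e * \1_[set y | k.+1%:R * e <= f y] x.

Lemma level_sum_le f e n x : 0 <= e -> 0 <= f x ->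
  level_sum f e n x <= f x /\ level_sum f e n x <= n%:R * e.
Proof.
move=> e0 f0; rewrite /level_sum; elim: n => [|n [ih1 ih2]].
  by rewrite big_ord0 mul0r.
rewrite !big_ord_recr/= indicE -natr1 mulrDl mul1r.
have [h|h] := leP (n%:R * e + e) (f x).
  by rewrite mem_set//= mulr1; split; lra.
by rewrite memNset ?mulr0n ?mulr0; [split; lra|apply/negP; rewrite -ltNge].
Qed.

Lemma level_sum_ge f e n x : 0 <= e ->
  f x - e <= level_sum f e n x \/ n%:R * e <= level_sum f e n x.
Proof.
move=> e0; rewrite /level_sum; elim: n => [|n ih].
  by right; rewrite big_ord0 mul0r.
rewrite !big_ord_recr/= indicE -natr1 mulrDl mul1r.
have [h|h] := leP (n%:R * e + e) (f x).
  by rewrite mem_set//= mulr1; case: ih => ih; [left|right]; lra.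
rewrite memNset ?mulr0n ?mulr0; last by apply/negP; rewrite -ltNge.
by left; case: ih => ih; lra.
Qed.

Lemma measurable_level (f : T -> R) (c : R) : continuous f ->
  measurable ([set y | c <= f y] : set (g_sigma_algebraType (@open T))).
Proof.
move=> cf; have -> : [set y | c <= f y] = f @^-1` `[c, +oo[%classic.
  by apply/seteqP; split=> y /=; rewrite in_itv/= andbT.
by rewrite -[X in measurable X]setTI; apply: continuous_measurable_borel.
Qed.

Lemma integral_level_sum (mu : probability (g_sigma_algebraType (@open T)) R)
    (f : T -> R) (e : R) n : 0 <= e -> continuous f ->
  (\int[mu]_x (level_sum f e n x)%:E =
   \sum_(k < n) e%:E * mu [set y | k.+1%:R * e <= f y]%R)%E.
Proof.
move=> e0 cf.
have mF (k : nat) := measurable_level (k.+1%:R * e) cf.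
under eq_integral do rewrite /level_sum -sumEFin.
rewrite ge0_integral_sum//.
- apply: eq_bigr => k _; under eq_integral do rewrite EFinM.
  rewrite ge0_integralZl//.
  + by rewrite integral_indic// setIT.
  + exact/measurable_EFinP/measurable_indic.
- move=> k; apply/measurable_EFinP; apply: measurable_funM; first exact: measurable_cst.
  exact: measurable_indic.
- by move=> k x _; rewrite lee_fin mulr_ge0// indicE.
Qed.

End LevelSets.

Section AbstractPietschDomination.
Context {R : realType} {T : ptopologicalType}.
Hypothesis hausT : hausdorff_space T.
Hypothesis cptT : compact [set: T].

Lemma closed_level (f : T -> R) c : continuous f -> closed [set y | c <= f y].
Proof.
move=> cf; have -> : [set y | c <= f y] = f @^-1` `[c, +oo[%classic.
  by apply/seteqP; split=> y /=; rewrite in_itv/= andbT.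
by apply: closed_comp => [y _|]; [exact: cf|exact: interval_closed].
Qed.

(** A positive normalized functional on the bounded functions lies below some
    regular Borel probability on the nonnegative continuous functions. *)
Theorem finitely_additive_le_integral (L : (T -> R) -> R) :
  (forall f g, fbounded f -> fbounded g -> L (f \+ g) = L f + L g) ->
  (forall (c : R) f, fbounded f -> L (c \*o f) = c * L f) ->
  (forall f g, fbounded f -> fbounded g -> (forall x, f x <= g x) -> L f <= L g) ->
  L (fun=> 1) = 1 ->
  exists mu : probability (g_sigma_algebraType (@open T)) R,
    regular_borel mu /\
    forall f : T -> R, continuous f -> (forall x, 0 <= f x) ->
      ((L f)%:E <= \int[mu]_x (f x)%:E)%E.
Proof.
move=> LD LZ Lmono L1.
have Lcst c : L (fun=> c) = c.
  have -> : (fun=> c) = c \*o (fun=> 1) :> (T -> R) by apply/funext => x /=; rewrite mulr1.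
  by rewrite LZ ?L1 ?mulr1//; exact: fbounded_cst.
have Lsum n (F : 'I_n -> T -> R) : (forall k, fbounded (F k)) ->
    L (fun x => \sum_(k < n) F k x) = \sum_(k < n) L (F k).
  move=> bF; elim: (index_enum _) => [|k r ih].
    by under eq_fun do rewrite big_nil; rewrite big_nil Lcst.
  under eq_fun do rewrite big_cons; rewrite big_cons -ih -LD//.
  exact: fbounded_sum.
have [|||mu [rmu Lmu]] := @content_le_regular_measure R T hausT cptT (fun A => L \1_A).
- move=> A; rewrite -[leLHS](Lcst 0); apply: Lmono => //.
  + exact: fbounded_cst.
  + exact: fbounded_indic.
- move=> A B AB; rewrite -LD; [|exact: fbounded_indic..].
  congr L; apply/funext => x /=; rewrite !indicE in_setU.
  have [xA|] := boolP (x \in A); have [xB|] := boolP (x \in B); rewrite ?addr0 ?add0r//.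
  exfalso; have : (A `&` B) x by split; exact: set_mem.
  by rewrite AB.
- by rewrite -[RHS]L1; congr L; apply/funext => x; rewrite indicE in_setT.
exists mu; split=> // f cf f0.
have [M fM] := compact_fbounded cptT cf.
have bf : fbounded f by exists M.
apply/lee_addgt0Pr => e e0.
(* With [n e >= M >= f], the function [f - e] lies below [level_sum f e n]. *)
pose n := (Num.truncn (M / e)).+1.
have nM : M <= n%:R * e.
  by rewrite -ler_pdivrMr// ltW// truncnS_gt.
have bl : fbounded (level_sum f e n).
  apply: fbounded_sum => k; apply: fboundedZ; exact: fbounded_indic.
have fl x : f x <= (level_sum f e n \+ fun=> e) x.
  have [/=|] := level_sum_ge f n x (ltW e0); first by rewrite lerBlDr.
  by move=> /= h; have := fM x; have := ler_norm (f x); lra.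
have Lf : L f <= L (level_sum f e n) + e.
  have be : fbounded (fun=> e : R) := @fbounded_cst R T e.
  rewrite -[X in _ + X](Lcst e) -LD//.
  by apply: (Lmono _ _ bf _ fl); exact: fboundedD.
apply: (@le_trans _ _ ((L (level_sum f e n))%:E + e%:E)%E); first by rewrite -EFinD lee_fin.
rewrite leeD2r//.
apply: (@le_trans _ _ (\int[mu]_x (level_sum f e n x)%:E)%E); last first.
  apply: ge0_le_integral => //.
  - by move=> x _; rewrite lee_fin sumr_ge0// => k _; rewrite mulr_ge0 ?(ltW e0)// indicE.
  - apply/measurable_EFinP; apply: measurable_sum => k.
    apply: measurable_funM; first exact: measurable_cst.
    by apply: measurable_indic; exact: measurable_level.
  - apply/measurable_EFinP. exact: continuous_measurable_borel.
  - by move=> x _; rewrite lee_fin; have [] := level_sum_le n (ltW e0) (f0 x).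
rewrite integral_level_sum ?(ltW e0)// /level_sum Lsum; last first.
  by move=> k; apply: fboundedZ; exact: fbounded_indic.
rewrite -sumEFin; apply: lee_sum => k _.
rewrite LZ; last exact: fbounded_indic.
by rewrite EFinM lee_pmul2l ?lte_fin//; apply: Lmu; exact: closed_level.
Qed.

(** If no nonnegative combination of the [f i - a i] is bounded above by a
    negative constant, a single measure makes every integral of [f i] at least
    [a i]. *)
Theorem abstract_pietsch_domination (I : Type) (f : I -> T -> R) (a : I -> R) :
  (forall i, continuous (f i)) -> (forall i x, 0 <= f i x) ->
  (forall (s : seq (R * I)) (e : R), all (fun l => 0 <= l.1) s -> 0 < e ->
     exists x, \sum_(l <- s) l.1 * a l.2 <= \sum_(l <- s) l.1 * f l.2 x + e) ->
  exists mu : probability (g_sigma_algebraType (@open T)) R,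
    regular_borel mu /\
    forall i, ((a i)%:E <= \int[mu]_x (f i x)%:E)%E.
Proof.
move=> cf f0 hs.
have bf i : fbounded (f i) by exact: compact_fbounded.
pose h (s : seq (R * I)) := fun x => \sum_(l <- s) l.1 * (f l.2 x - a l.2).
pose H := [set g | exists2 s, all (fun l => 0 <= l.1) s & g = h s].
have [|||||L [LD LZ Lmono L1 LH]] := @finitely_additive_integral R T H.
- by exists (h [::]), [::].
- move=> _ [s _ ->]; apply: fbounded_sum => l; apply: fboundedZ.
  by apply: fboundedD => //; exact: fbounded_cst.
- move=> _ _ [s ps ->] [t pt ->]; exists (s ++ t); first by rewrite all_cat ps pt.
  by apply/funext => x /=; rewrite /h big_cat.
- move=> t _ t0 [s ps ->]; exists [seq (t * l.1, l.2) | l <- s].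
    rewrite all_map; apply: sub_all ps => l /= l0; exact: mulr_ge0.
  by apply/funext => x /=; rewrite /h big_map mulr_sumr; apply: eq_bigr => l _ /=; rewrite mulrA.
- move=> _ e [s ps ->] e0; have [x hx] := hs s e ps e0; exists x.
  rewrite /h; under eq_bigr do rewrite mulrBr.
  by rewrite sumrB; lra.
have [mu [rmu Lmu]] := finitely_additive_le_integral LD LZ Lmono L1.
exists mu; split=> // i; apply: le_trans (Lmu _ (cf i) (f0 i)).
have : 0 <= L (h [:: (1, i)]) by apply: LH; exists [:: (1, i)]; rewrite //= ler01.
have -> : h [:: (1, i)] = f i \+ ((- a i) \*o (fun=> 1)).
  by apply/funext => x; rewrite /h big_seq1/= mul1r mulr1.
rewrite LD ?LZ ?L1 ?mulr1 ?lee_fin ?subr_ge0//; first exact: fbounded_cst.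
by apply: fboundedZ; exact: fbounded_cst.
Qed.

End AbstractPietschDomination.

(** * Real-valued norms and bounded families of scalars *)

Section RealNorm.
Context {R : realType} {s : scalar_kind}.
Local Notation K := (scalar_field R s).

(** The embedding of the reals in the scalar field. *)
Definition scalar_of_real : R -> K :=
  match s return R -> scalar_field R s with
  | RealScalars => fun r => r
  | ComplexScalars => fun r => real_complex R r
  end.

Lemma scalar_of_realK r : real_part (scalar_of_real r) = r.
Proof. by rewrite /scalar_of_real /real_part; case: s. Qed.

Lemma le_scalar_of_real r t : (scalar_of_real r <= scalar_of_real t) = (r <= t).
Proof. by rewrite /scalar_of_real; case: s => //; exact: lecR. Qed.

Lemma lt_scalar_of_real r t : (scalar_of_real r < scalar_of_real t) = (r < t).
Proof. by rewrite /scalar_of_real; case: s => //; exact: ltcR. Qed.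

Lemma scalar_of_realD r t :
  scalar_of_real (r + t) = scalar_of_real r + scalar_of_real t.
Proof. by rewrite /scalar_of_real; case: s => //; exact: (rmorphD (real_complex R)). Qed.

Lemma scalar_of_realM r t :
  scalar_of_real (r * t) = scalar_of_real r * scalar_of_real t.
Proof. by rewrite /scalar_of_real; case: s => //; exact: (rmorphM (real_complex R)). Qed.

Lemma scalar_of_real0 : scalar_of_real 0 = 0.
Proof. by rewrite /scalar_of_real; case: s. Qed.

Lemma scalar_of_real1 : scalar_of_real 1 = 1.
Proof. by rewrite /scalar_of_real; case: s. Qed.

Lemma real_partK (k : K) : 0 <= k -> scalar_of_real (real_part k) = k.
Proof.
rewrite /scalar_of_real /real_part; move: k; case: s => // k k0.
exact: (RRe_real (ger0_real k0)).
Qed.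

Variable V : normedModType K.
Implicit Types u v : V.

Lemma rnormE v : `|v| = scalar_of_real (rnorm v).
Proof. by rewrite real_partK. Qed.

Lemma rnorm_ge0 v : 0 <= rnorm v.
Proof. by rewrite -le_scalar_of_real -rnormE scalar_of_real0. Qed.

Lemma rnorm0 : rnorm (0 : V) = 0.
Proof. by rewrite /rnorm normr0 -scalar_of_real0 scalar_of_realK. Qed.

Lemma rnorm_eq0 v : rnorm v = 0 -> v = 0.
Proof. by move=> h; apply/eqP; rewrite -normr_eq0 rnormE h scalar_of_real0. Qed.

Lemma rnormN v : rnorm (- v) = rnorm v.
Proof. by rewrite /rnorm normrN. Qed.

Lemma ler_rnormD u v : rnorm (u + v) <= rnorm u + rnorm v.
Proof. by rewrite -le_scalar_of_real scalar_of_realD -!rnormE ler_normD. Qed.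

Lemma rnormB u v : rnorm (u - v) = rnorm (v - u).
Proof. by rewrite -rnormN opprB. Qed.

Lemma ler_rnorm_sum I (r : seq I) (P : pred I) (F : I -> V) :
  rnorm (\sum_(i <- r | P i) F i) <= \sum_(i <- r | P i) rnorm (F i).
Proof.
elim/big_rec2: _ => [|i y z _ h]; first by rewrite rnorm0.
by rewrite (le_trans (ler_rnormD _ _))// lerD2l.
Qed.

Lemma rnormZ (k : K) v : rnorm (k *: v) = rnorm (k : K^o) * rnorm v.
Proof.
rewrite -[LHS]scalar_of_realK -[RHS]scalar_of_realK; congr real_part.
by rewrite scalar_of_realM /rnorm !real_partK ?normr_ge0// normrZ.
Qed.

Lemma ler_dist_rnorm u v : `|rnorm u - rnorm v| <= rnorm (u - v).
Proof.
have h1 := ler_rnormD (u - v) v; have h2 := ler_rnormD (v - u) u.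
rewrite !subrK in h1 h2; rewrite (rnormB v u) in h2.
by rewrite ler_norml; apply/andP; split; lra.
Qed.

Lemma rnorm_cvgP {U : Type} {F : set_system U} {FF : Filter F} (f : U -> V) (l : V) :
  f @ F --> l <-> forall e : R, 0 < e -> \forall x \near F, rnorm (l - f x) < e.
Proof.
split=> [/cvgrPdist_lt h e e0|h].
  have /h : 0 < scalar_of_real e by rewrite -scalar_of_real0 lt_scalar_of_real.
  by apply: filterS => x; rewrite rnormE lt_scalar_of_real.
apply/cvgrPdist_lt => e e0; rewrite -(real_partK (ltW e0)).
have /h : 0 < real_part e.
  by rewrite -lt_scalar_of_real scalar_of_real0 real_partK// ltW.
by apply: filterS => x; rewrite rnormE lt_scalar_of_real.
Qed.

Lemma rnorm_cvg {U : Type} {F : set_system U} {FF : Filter F} (f : U -> V) (l : V) :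
  f @ F --> l -> (fun x => rnorm (f x)) @ F --> rnorm l.
Proof.
move=> /rnorm_cvgP h; apply/cvgrPdist_lt => e /h; apply: filterS => x.
exact: le_lt_trans (ler_dist_rnorm _ _).
Qed.

Lemma ler_rnorm_lim {U : Type} {F : set_system U} {FF : ProperFilter F}
    (f : U -> V) (l : V) (r : R) :
  f @ F --> l -> (\forall x \near F, rnorm (f x) <= r) -> rnorm l <= r.
Proof.
move=> /rnorm_cvgP fl fr; apply/ler_addgt0Pr => e e0.
have [x [h1 h2]] := filter_ex (filterI (fl e e0) fr).
by rewrite -[l](subrK (f x)) (le_trans (ler_rnormD _ _))// addrC lerD// ltW.
Qed.

End RealNorm.

Arguments scalar_of_real {R s}.

Section ScalarCompactness.
Context {R : realType}.

Lemma bounded_ultra_cvg_real (U : Type) (F : set_system U) (f : U -> R) (r : R) :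
  UltraFilter F -> (\forall u \near F, `|f u| <= r) -> exists l : R, f @ F --> l.
Proof.
move=> UF fr; have FF : ProperFilter F by exact: ultra_proper.
have [|l [_ lF]] := @segment_compact R (- r) r (f @ F) _.
  by apply: (filterS _ fr) => u; rewrite /= in_itv/= -ler_norml.
exists l => A lA; have [//|FnA] := in_ultra_setVsetC (f @^-1` A) UF.
by have [x [nAx Ax]] := lF (~` A) A FnA lA.
Qed.

(** In the complex case the real and imaginary parts converge separately. *)
Lemma bounded_ultra_cvg (s : scalar_kind) (U : Type) (F : set_system U)
    (f : U -> (scalar_field R s)^o) (r : R) :
  UltraFilter F -> (\forall u \near F, rnorm (f u) <= r) ->
  exists l : (scalar_field R s)^o, f @ F --> l.
Proof.
case: s f => f UF fr; first exact: bounded_ultra_cvg_real fr.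
have FF : ProperFilter F by exact: ultra_proper.
have normE (z : (scalar_field R ComplexScalars)^o) :
    rnorm z = Num.sqrt (complex.Re z ^+ 2 + complex.Im z ^+ 2).
  exact: (congr1 (@complex.Re R) (normc_def (z : complex R))).
have [|a fa] := @bounded_ultra_cvg_real U F (fun u => complex.Re (f u)) r UF.
  apply: (filterS _ fr) => u; apply: le_trans; rewrite normE -sqrtr_sqr ler_sqrt.
    by rewrite lerDl sqr_ge0.
  by rewrite addr_ge0 ?sqr_ge0.
have [|b fb] := @bounded_ultra_cvg_real U F (fun u => complex.Im (f u)) r UF.
  apply: (filterS _ fr) => u; apply: le_trans; rewrite normE -sqrtr_sqr ler_sqrt.
    by rewrite lerDr sqr_ge0.
  by rewrite addr_ge0 ?sqr_ge0.
exists (Complex a b); apply/rnorm_cvgP => e e0.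
have e20 : 0 < e / 2 by rewrite divr_gt0.
move/cvgrPdist_lt: fa => /(_ _ e20) fa; move/cvgrPdist_lt: fb => /(_ _ e20) fb.
apply: filterS2 fa fb => u; rewrite normE.
case: (f u) => c d /= h1 h2.
rewrite -(ger0_norm (ltW e0)) -sqrtr_sqr ltr_sqrt; last by rewrite exprn_gt0.
rewrite -(real_normK (num_real (a - c))) -(real_normK (num_real (b - d))).
have := normr_ge0 (a - c); have := normr_ge0 (b - d); nra.
Qed.

End ScalarCompactness.

(** * Multilinear maps and polarization *)

Section Multilinear.
Context {R : realType} {s : scalar_kind}.
Local Notation K := (scalar_field R s).
Context {m : nat} {X Y : lmodType K}.
Implicit Types (x y : 'I_m -> X) (i : 'I_m).

Lemma dfwith_if x i (v : X) : dfwith x i v = fun j => if j == i then v else x j.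
Proof.
apply/funext => j; have [->|ji] := eqVneq j i; first by rewrite dfwithin.
by rewrite dfwithout// eq_sym.
Qed.

Variable A : ('I_m -> X) -> Y.
Hypothesis mA : multilinear A.

Lemma multilinearD x i u v :
  A (dfwith x i (u + v)) = A (dfwith x i u) + A (dfwith x i v).
Proof. by have := mA i x 1 u v; rewrite !scale1r. Qed.

Lemma multilinear0 x i : A (dfwith x i 0) = 0.
Proof. by apply: (addrI (A (dfwith x i 0))); rewrite -multilinearD !addr0. Qed.

Lemma multilinearZ x i (a : K) v : A (dfwith x i (a *: v)) = a *: A (dfwith x i v).
Proof. by have := mA i x a v 0; rewrite multilinear0 !addr0. Qed.

Lemma multilinearB x i u v :
  A (dfwith x i (u - v)) = A (dfwith x i u) - A (dfwith x i v).
Proof. by rewrite multilinearD -scaleN1r multilinearZ scaleN1r. Qed.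

Lemma multilinear_sum x i J (r : seq J) (g : J -> X) :
  A (dfwith x i (\sum_(j <- r) g j)) = \sum_(j <- r) A (dfwith x i (g j)).
Proof.
elim: r => [|j r ih]; first by rewrite !big_nil multilinear0.
by rewrite !big_cons multilinearD ih.
Qed.

Lemma multilinear_eq0 x i : x i = 0 -> A x = 0.
Proof.
move=> xi; rewrite -(multilinear0 x i); congr A; rewrite dfwith_if.
by apply/funext => j; case: eqP => // ->.
Qed.

Lemma lmod_mulrnI (n : nat) (u v : Y) : (n != 0)%N -> u *+ n = v *+ n -> u = v.
Proof.
move=> n0; have nK : (n%:R : K) != 0 by rewrite pnatr_eq0.
by move=> uv; apply: (scalerI nK); rewrite !scaler_nat.
Qed.

(** Full expansion of a multilinear map.  Summing over all [f], and not only
    over the values of [f] on the slots already expanded, makes expanding one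
    more slot [i0] a mere reindexing, by the involution
    [(f, j) |-> (f with i0 |-> j, f i0)], at the price of a factor [#|J|]. *)
Lemma multilinear_expand (J : finType) (F : 'I_m -> J -> X) : (0 < #|J|)%N ->
  A (fun i => \sum_j F i j) = \sum_(f : {ffun 'I_m -> J}) A (fun i => F i (f i)).
Proof.
move=> J0; pose S i := \sum_j F i j.
pose T (r : seq 'I_m) (f : {ffun 'I_m -> J}) :=
  A (fun i => if i \in r then F i (f i) else S i).
have step i0 r : i0 \notin r ->
    \sum_f T r f = (\sum_f T (i0 :: r) f) *+ #|J|.
  move=> i0r; pose upd (f : {ffun 'I_m -> J}) j := [ffun i => if i == i0 then j else f i].
  pose h (p : {ffun 'I_m -> J} * J) := (upd p.1 p.2, p.1 i0).
  have hK : involutive h.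
    move=> [f j]; rewrite /h /=; congr pair; last by rewrite ffunE eqxx.
    by apply/ffunP => i; rewrite !ffunE; case: eqP => // ->.
  transitivity (\sum_f \sum_j T (i0 :: r) (upd f j)).
    apply: eq_bigr => f _; rewrite /T.
    have -> : (fun i => if i \in r then F i (f i) else S i) =
        dfwith (fun i => if i \in r then F i (f i) else S i) i0 (S i0).
      rewrite dfwith_if; apply/funext => i.
      by case: (eqVneq i i0) => // ->; rewrite (negbTE i0r).
    rewrite multilinear_sum; apply: eq_bigr => j _; congr A.
    rewrite dfwith_if; apply/funext => i; rewrite in_cons ffunE.
    by case: (eqVneq i i0) => //= ->.
  rewrite pair_bigA (reindex_inj (inv_inj hK))/=.
  rewrite (eq_bigr (fun p => T (i0 :: r) p.1)); last first.
    by move=> p _; have /(congr1 fst) /= -> := hK p.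
  rewrite -(pair_bigA _ (fun f _ => T (i0 :: r) f))/= -sumrMnl.
  by apply: eq_bigr => f _; rewrite sumr_const.
have expand r : uniq r -> \sum_f T [::] f = (\sum_f T r f) *+ (#|J| ^ size r).
  elim: r => [_|i r ih /= /andP[ir ur]]; first by rewrite expn0.
  by rewrite (ih ur) (step _ _ ir) -mulrnA expnS.
have := expand (enum 'I_m) (enum_uniq _).
rewrite (eq_bigr (fun=> A S))// sumr_const card_ffun -cardE card_ord.
have N0 : (#|J| ^ m != 0)%N by rewrite expn_eq0 negb_and -lt0n J0.
move=> /(lmod_mulrnI N0) ->.
by apply: eq_bigr => f _; congr A; apply/funext => i; rewrite mem_enum.
Qed.

(** The slots are scaled one after the other. *)
Lemma multilinear_scale (a : K) x : A (fun i => a *: x i) = a ^+ m *: A x.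
Proof.
have step k : (k <= m)%N ->
    A (fun i => if (i < k)%N then a *: x i else x i) = a ^+ k *: A x.
  elim: k => [_|k ih km]; first by rewrite scale1r.
  pose i0 := Ordinal km; pose y i := if (i < k)%N then a *: x i else x i.
  rewrite exprS -scalerA -ih ?(ltnW km)// -/y.
  have -> : A y = A (dfwith y i0 (x i0)).
    congr A; rewrite dfwith_if; apply/funext => i.
    by case: eqP => // ->; rewrite /y ltnn.
  rewrite -multilinearZ; congr A; rewrite dfwith_if; apply/funext => i.
  rewrite /y ltnS leq_eqVlt -(inj_eq val_inj)/=.
  by case: (eqVneq (i : nat) k) => //= ik; congr (_ *: x _); exact: val_inj.
rewrite -(step m (leqnn m)); congr A; apply/funext => i; by rewrite ltn_ord.
Qed.

End Multilinear.

Section Polarization.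
Context {R : realType} {s : scalar_kind}.
Local Notation K := (scalar_field R s).
Context {m : nat} {X : lmodType K}.

(** Up to the factor [(-1)^m m!], the polar form of [q].  It is defined for any
    function [q], and depends on finitely many values of [q] only, so that it
    passes to pointwise limits. *)
Definition polarize (q : X -> K^o) (x : 'I_m -> X) : K^o :=
  \sum_(S : {set 'I_m}) (-1) ^+ #|S| * q (\sum_(i in S) x i).

(** The signs cancel in the pairs [S], [S] with [j] added or removed. *)
Lemma sum_sign_notin (P : pred {set 'I_m}) (j : 'I_m) :
  (forall S, P (j |: S) = P S) ->
  \sum_(S | P S) (-1) ^+ #|S| = 0 :> K.
Proof.
move=> Pj; have PD S : P (S :\ j) = P S.
  have [jS|jS] := boolP (j \in S); first by rewrite -[in RHS](finset.setD1K jS) Pj.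
  congr P; apply/finset.setP => i; rewrite !inE; case: eqP => // ->.
  by rewrite (negbTE jS).
pose tog (S : {set 'I_m}) := if j \in S then S :\ j else j |: S.
have togK : involutive tog.
  move=> S; rewrite /tog; have [jS|jS] := boolP (j \in S).
    by rewrite finset.setD11 finset.setD1K.
  by rewrite finset.setU11 finset.setU1K.
set c := LHS; have cN : c = - c.
  rewrite {1}/c (reindex_inj (inv_inj togK)) -sumrN; apply: eq_big => S.
    by rewrite /tog; case: ifP => _; rewrite ?PD ?Pj.
  rewrite /tog; have [jS|jS] := boolP (j \in S) => _.
    by rewrite [in RHS](cardsD1 j S) jS add1n exprS mulN1r opprK.
  by rewrite cardsU1 jS add1n exprS mulN1r.
apply/eqP; have : c *+ 2 == 0 by rewrite mulr2n {1}cN addNr.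
by rewrite mulrn_eq0.
Qed.

(** The polarization formula.  Expanding [A] gives a sum over all maps [f] of
    the indices to themselves; the terms of a map that misses an index cancel,
    and only the permutations remain. *)
Lemma polarizeE (A : ('I_m -> X) -> K^o) (q : X -> K^o) (x : 'I_m -> X) :
  (0 < m)%N -> multilinear A -> (forall v, q v = A (fun=> v)) ->
  polarize q x = (-1) ^+ m *:
    \sum_(f : {ffun 'I_m -> 'I_m} | injectiveb f) A (fun i => x (f i)).
Proof.
move=> m0 mA qA.
pose ok (f : {ffun 'I_m -> 'I_m}) (S : {set 'I_m}) := [forall k, f k \in S].
transitivity (\sum_(S : {set 'I_m}) \sum_(f : {ffun 'I_m -> 'I_m} | ok f S)
    (-1) ^+ #|S| * A (fun i => x (f i))).
  apply: eq_bigr => S _; rewrite qA -mulr_sumr; congr (_ * _).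
  have -> : A (fun=> \sum_(i in S) x i) =
      A (fun k : 'I_m => \sum_i (if i \in S then x i else 0)).
    by congr A; apply/funext => k; rewrite big_mkcond.
  rewrite multilinear_expand ?card_ord// [RHS]big_mkcond; apply: eq_bigr => f _.
  case: ifPn => [/forallP fS|/forallPn[k fkS]].
    by congr A; apply/funext => k; rewrite fS.
  by apply: (multilinear_eq0 mA (i := k)); rewrite (negbTE fkS).
rewrite (exchange_big_dep xpredT)//= scaler_sumr [RHS]big_mkcond.
apply: eq_bigr => f _; rewrite -mulr_suml; case: ifPn => [finj|fninj].
  rewrite (big_pred1 (finset.setTfor 'I_m)); first by rewrite cardsT card_ord.
  move=> S; apply/forallP/eqP => [fS|-> k]; last by rewrite inE.
  have /injectiveP finj' := finj.
  by apply/finset.setP => i; rewrite inE -(f_invF finj' i) fS.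
have [j jf] : exists j, j \notin codom f.
  apply: contrapT => /forallNP noj; case/negP: fninj; apply/injectiveP => a b.
  suff /fintype.image_injP h : #|codom f| == #|'I_m| by exact: h.
  by apply/eqP/eq_card => j; rewrite inE; apply: contrapT => /negP /noj.
rewrite (sum_sign_notin (j := j)) ?mul0r// => S.
apply: eq_forallb => k; rewrite !inE; case: eqP => // fkj.
by rewrite -fkj codom_f in jf.
Qed.

Lemma multilinear_polarize (q : X -> K^o) : (0 < m)%N ->
  homogeneous_polynomial m q -> multilinear (polarize q).
Proof.
move=> m0 [A [mA qA]] i x a u v /=.
rewrite !(polarizeE _ m0 mA qA) scalerA [a * _]mulrC -scalerA -scalerDr; congr (_ *: _).
rewrite scaler_sumr -big_split; apply: eq_bigr => f /injectiveP finj /=.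
have fE w : (fun k => dfwith x i w (f k)) = dfwith (x \o f) (invF finj i) w.
  apply/funext => k; rewrite !dfwith_if; congr (if _ then _ else _).
  by apply/eqP/eqP => [<-|->]; rewrite ?invF_f ?f_invF.
by rewrite !fE; exact: mA.
Qed.

Lemma polarize_diag (q : X -> K^o) x : (0 < m)%N -> homogeneous_polynomial m q ->
  polarize q (fun=> x) = ((-1) ^+ m * (m`!)%:R) *: q x.
Proof.
move=> m0 [A [mA qA]]; rewrite (polarizeE _ m0 mA qA) -scalerA; congr (_ *: _).
rewrite sumr_const -qA scaler_nat; congr (_ *+ _).
have := card_inj_ffuns 'I_m 'I_m; rewrite card_ord ffactnn => <-.
by apply: eq_card => f; rewrite inE.
Qed.

End Polarization.

(** * Pointwise limits of homogeneous polynomials *)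

Section HomogeneousPolynomialLimits.
Context {R : realType} {s : scalar_kind}.
Local Notation K := (scalar_field R s).
Context {m : nat} {X : normedModType K}.

Lemma rnormM (a b : K) : rnorm (a * b : K^o) = rnorm (a : K^o) * rnorm (b : K^o).
Proof. exact: (@rnormZ R s K^o a (b : K^o)). Qed.

Lemma rnorm_scalar_of_real (r : R) : 0 <= r -> rnorm (scalar_of_real r : K^o) = r.
Proof.
move=> r0; rewrite /rnorm ger0_norm ?scalar_of_realK//.
by rewrite -(@scalar_of_real0 R s) le_scalar_of_real.
Qed.

Lemma rnorm1 : rnorm (1 : K^o) = 1.
Proof. by rewrite -[X in rnorm X](@scalar_of_real1 R s) rnorm_scalar_of_real. Qed.

Lemma rnormX (a : K) n : rnorm (a ^+ n : K^o) = rnorm (a : K^o) ^+ n.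
Proof.
by elim: n => [|n ih]; rewrite ?expr0 ?rnorm1// !exprS rnormM ih.
Qed.

Lemma unit_ball_scale (V : normedModType K) (x : V) :
  exists2 u : V, rnorm u <= 1 & x = scalar_of_real (rnorm x) *: u.
Proof.
have [x0|x0] := eqVneq (rnorm x) 0.
  exists 0; first by rewrite rnorm0.
  by rewrite scaler0; exact: rnorm_eq0.
have e0 : scalar_of_real (rnorm x) != 0 :> K.
  by rewrite -rnormE normr_eq0; apply: contra_neq x0 => ->; rewrite rnorm0.
exists ((scalar_of_real (rnorm x))^-1 *: x); last by rewrite scalerA divff// scale1r.
rewrite -(@ler_pM2l _ (rnorm x)) ?lt_neqAle 1?eq_sym ?x0 ?rnorm_ge0// mulr1.
rewrite -[X in X * _](rnorm_scalar_of_real (rnorm_ge0 x)) -rnormZ.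
by rewrite scalerA divff// scale1r.
Qed.

Lemma homogeneous_polynomialZ (q : X -> K^o) (a : K) x :
  homogeneous_polynomial m q -> q (a *: x) = a ^+ m *: q x.
Proof. by move=> [A [mA qA]]; rewrite !qA multilinear_scale. Qed.

Lemma hompoly_ball_bound (q : hompoly m X K^o) x :
  (hompoly_norm q <= 1)%E -> rnorm (q x) <= rnorm x ^+ m.
Proof.
move=> q1; have [u u1 {1}->] := unit_ball_scale x.
rewrite (homogeneous_polynomialZ _ _ (hompolyP q)) rnormZ rnormX.
rewrite rnorm_scalar_of_real ?rnorm_ge0// ler_piMr ?exprn_ge0 ?rnorm_ge0//.
by rewrite -lee_fin; apply: le_trans q1; apply: ereal_sup_ubound; exists u.
Qed.

(** Replacing [a] by [x] in one slot after the other shows that the diagonal is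
    Lipschitz near [a]. *)
Lemma multilinear_diag_continuous (A : ('I_m -> X) -> K^o) : multilinear A ->
  (forall r : R, exists M : R, forall x : 'I_m -> X,
     (forall i, rnorm (x i) <= r) -> rnorm (A x) <= M) ->
  continuous (fun x => A (fun=> x)).
Proof.
move=> mA bA a; have [M AM] := bA (rnorm a + 1).
have M0 : 0 <= M.
  apply: le_trans (AM (fun=> a) _); first exact: rnorm_ge0.
  by move=> i; rewrite lerDl.
have lip x : rnorm (x - a) <= 1 ->
    rnorm (A (fun=> x) - A (fun=> a)) <= m%:R * (M * rnorm (x - a)).
  move=> xa; pose g k (i : 'I_m) := if (i < k)%N then x else a.
  have xr : rnorm x <= rnorm a + 1.
    by rewrite -[x](subrK a) (le_trans (ler_rnormD _ _))// addrC lerD2l.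
  have step k : (k <= m)%N -> rnorm (A (g k) - A (g 0%N)) <= k%:R * (M * rnorm (x - a)).
    elim: k => [_|k ih km]; first by rewrite subrr rnorm0 mul0r.
    rewrite -(subrK (A (g k)) (A (g k.+1))) -addrA (le_trans (ler_rnormD _ _))//.
    rewrite -natr1 mulrDl mul1r [leRHS]addrC lerD ?ih ?(ltnW km)//.
    pose i0 := Ordinal km.
    have -> : g k.+1 = dfwith (g k) i0 x.
      rewrite dfwith_if; apply/funext => i; rewrite /g ltnS leq_eqVlt.
      by rewrite -(inj_eq val_inj)/=; case: (eqVneq (i : nat) k).
    have gE : g k = dfwith (g k) i0 a.
      rewrite dfwith_if; apply/funext => i; rewrite /g.
      by case: (eqVneq i i0) => // ->; rewrite ltnn.
    rewrite [X in _ - A X]gE -multilinearB//; have [u u1 {1}->] := unit_ball_scale (x - a).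
    rewrite multilinearZ// rnormZ rnorm_scalar_of_real ?rnorm_ge0// mulrC.
    rewrite ler_wpM2r ?rnorm_ge0//; apply: AM => i; rewrite dfwith_if.
    case: ifP => _; first by rewrite (le_trans u1)// lerDr rnorm_ge0.
    by rewrite /g; case: ifP => _ //; rewrite lerDl.
  have := step m (leqnn m).
  suff -> : g m = fun=> x by [].
  by apply/funext => i; rewrite /g ltn_ord.
apply/rnorm_cvgP => e e0.
have B0 : 0 < m%:R * M + 1 by rewrite ltr_wpDl// mulr_ge0.
have /(@rnorm_cvgP R s X _ _ _ id) cvid : x @[x --> a] --> a by exact: cvg_id.
have d0 : 0 < Num.min 1 (e / (m%:R * M + 1)) by rewrite lt_min ltr01 divr_gt0.
have := cvid _ d0; apply: filterS => x /=; rewrite lt_min => /andP[h1 h2].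
rewrite rnormB (le_lt_trans (lip _ _))//; rewrite rnormB; first exact: ltW.
rewrite mulrA; move: h2; rewrite ltr_pdivlMr// mulrDr mulr1 mulrC => h2.
by have := rnorm_ge0 (a - x); lra.
Qed.

Lemma cvg_lincomb {U : Type} {F : set_system U} {FF : Filter F}
    (q : U -> X -> K^o) (phi : X -> K^o) I (r : seq I) (c : I -> K) (y : I -> X) :
  (forall x, q t x @[t --> F] --> phi x) ->
  (\sum_(i <- r) c i * q t (y i) : K^o) @[t --> F] --> (\sum_(i <- r) c i * phi (y i) : K^o).
Proof.
move=> qphi; elim: r => [|i r ih].
  by rewrite big_nil; under eq_fun do rewrite big_nil; exact: cvg_cst.
rewrite big_cons; under eq_fun do rewrite big_cons.
apply: cvgD ih; exact: cvgZl_tmp.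
Qed.

Lemma cvg_lim_unique {U : Type} {F : set_system U} {FF : ProperFilter F}
    (f : U -> K^o) (k l : K^o) : f @ F --> k -> f @ F --> l -> k = l.
Proof. by move=> fk fl; exact: (cvg_unique (@norm_hausdorff _ K^o) fk fl). Qed.

(** The unit ball of the homogeneous polynomials is closed under pointwise
    limits.  Polar forms converge along with the polynomials, so the limit has
    a multilinear polar form; that form is bounded on bounded sets, whence the
    continuity of the limit. *)
Lemma hompoly_ball_limit {U : Type} {F : set_system U} {FF : ProperFilter F}
    (q : U -> hompoly m X K^o) (phi : X -> K^o) : (0 < m)%N ->
  (forall t, (hompoly_norm (q t) <= 1)%E) ->
  (forall x, q t x @[t --> F] --> phi x) ->
  exists q0 : hompoly m X K^o, (hompoly_norm q0 <= 1)%E /\ forall x, q0 x = phi x.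
Proof.
move=> m0 q1 qphi.
have cvg_polar (x : 'I_m -> X) : polarize (q t) x @[t --> F] --> polarize phi x.
  exact: (cvg_lincomb qphi).
have mphi : multilinear (@polarize R s m X phi).
  move=> i x a u v /=. apply: (cvg_lim_unique (cvg_polar _)).
  under eq_fun do rewrite (multilinear_polarize m0 (hompolyP (q _)) i x a u v).
  by apply: cvgD; [apply: cvgZl_tmp|]; exact: cvg_polar.
pose c : K := (-1) ^+ m * (m`!)%:R.
have c0 : c != 0 by rewrite mulf_neq0 ?signr_eq0// pnatr_eq0 -lt0n fact_gt0.
have phiE x : phi x = c^-1 *: polarize phi (fun _ : 'I_m => x).
  have : polarize phi (fun _ : 'I_m => x) = c *: phi x.
    apply: (cvg_lim_unique (cvg_polar _)).
    under eq_fun do rewrite (polarize_diag _ m0 (hompolyP (q _))).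
    exact: cvgZl_tmp.
  by move=> ->; rewrite scalerA mulVf// scale1r.
have phib x : rnorm (phi x) <= rnorm x ^+ m.
  apply: (ler_rnorm_lim (qphi x)); apply: nearW => t; exact: hompoly_ball_bound.
have hphi : homogeneous_polynomial m phi.
  exists (fun x : 'I_m -> X => c^-1 *: polarize phi x); split=> // i x a u v.
  by rewrite mphi scalerDr !scalerA mulrC.
have cphi : continuous phi.
  have -> : phi = (fun x => c^-1 *: polarize phi (fun _ : 'I_m => x)) by apply/funext.
  move=> a; apply: cvgZl_tmp; apply: (multilinear_diag_continuous mphi) => r.
  exists (\sum_(S : {set 'I_m}) (m%:R * r) ^+ m) => x xr.
  rewrite /polarize; apply: (le_trans (ler_rnorm_sum _ _ _)); apply: ler_sum => S _.
  rewrite rnormM rnormX rnormN rnorm1 expr1n mul1r (le_trans (phib _))//.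
  have r0 : 0 <= r by rewrite (le_trans (rnorm_ge0 (x (Ordinal m0)))).
  rewrite lerXn2r ?nnegrE ?rnorm_ge0 ?mulr_ge0//.
  apply: (le_trans (ler_rnorm_sum _ _ _)); rewrite big_mkcond.
  apply: (@le_trans _ _ (\sum_(i < m) r)); last by rewrite sumr_const card_ord mulr_natl.
  by apply: ler_sum => i _; case: ifP.
exists (HomPoly hphi cphi); split=> //.
apply: ge_ereal_sup => _ [x x1 <-]; rewrite lee_fin /=.
apply: (le_trans (phib x)); rewrite exprn_ile1 ?rnorm_ge0//.
Qed.

End HomogeneousPolynomialLimits.

(** * The dual ball is compact and Hausdorff *)

Section InitialConvergence.

Lemma cvg_initial (S : choiceType) (T : topologicalType) (f : S -> T)
    (F : set_system S) (x : S) :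
  Filter F -> f @ F --> f x -> F --> (x : initial_topology f).
Proof.
move=> FF fF A /= [_ [[B oB <-] Bfx sBA]].
by apply: (filterS sBA); apply: fF; exact: open_nbhs_nbhs.
Qed.

Lemma cvg_ptws (I : choiceType) (T : topologicalType)
    (F : set_system (I -> T)) (g : I -> T) :
  Filter F -> (forall i, h i @[h --> F] --> g i) -> F --> (g : {ptws I -> T}).
Proof.
move=> FF h; apply/cvg_sup => i; exact: (cvg_initial (f := fun g : I -> T => g i)).
Qed.

End InitialConvergence.

Section DualBall.
Context {R : realType} {s : scalar_kind}.
Local Notation K := (scalar_field R s).
Context {m : nat} {X : normedModType K}.
Implicit Types (q : hompoly m X K^o) (z w : seq (K * X)).

Lemma pairing0_bound q z : (hompoly_norm q <= 1)%E ->
  rnorm (pairing0 q z) <= \sum_(l <- z) rnorm (l.1 : K^o) * rnorm l.2 ^+ m.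
Proof.
move=> q1; apply: (le_trans (ler_rnorm_sum _ _ _)); apply: ler_sum => l _.
by rewrite rnormM ler_wpM2l ?rnorm_ge0//; exact: hompoly_ball_bound.
Qed.

Lemma pairing0_pi_s q z w : (hompoly_norm q <= 1)%E ->
  ((rnorm (pairing0 q z - pairing0 q w))%:E <=
   pi_s (fun A : multilinear_form m X => tensor_of z A - tensor_of w A)%R)%E.
Proof.
move=> q1; apply: le_ereal_inf_tmp => _ [y yzw <-].
have [A [mA qA]] := hompolyP q.
have tE u : pairing0 q u = tensor_of u (exist _ A mA : multilinear_form m X).
  by apply: eq_bigr => l _; rewrite qA.
have -> : pairing0 q z - pairing0 q w = pairing0 q y by rewrite !tE yzw.
by rewrite lee_fin; exact: pairing0_bound.
Qed.

(** On the unit ball, the values on a completed tensor are uniformly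
    approximated by the values on a tensor. *)
Lemma pairing_approx (z : completed_tensor m X) (e : R) : 0 < e ->
  exists n, forall q, (hompoly_norm q <= 1)%E ->
    rnorm (pairing q z - pairing0 q (sval z n)) <= e.
Proof.
move: z => [u cu] e0 /=; have [n un] := cu e e0; exists n => q q1.
have cauchy (d : R) : 0 < d -> exists N, forall j k, (N <= j)%N -> (N <= k)%N ->
    rnorm (pairing0 q (u j) - pairing0 q (u k)) < d.
  move=> d0; have [N uN] := cu d d0; exists N => j k Nj Nk.
  by rewrite -lte_fin (le_lt_trans (pairing0_pi_s _ _ q1))// uN.
pose x k := pairing0 q (u k).
suff [l xl] : exists l : K^o, x @ \oo --> l.
  have -> : pairing q (exist _ u cu) = l by exact: cvg_lim.
  have : (fun k => x k - x n) @ \oo --> l - x n by apply: cvgB => //; exact: cvg_cst.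
  move=> /ler_rnorm_lim; apply; near=> k.
  rewrite -lee_fin ltW// (le_lt_trans (pairing0_pi_s _ _ q1))// un//.
  by near: k; exact: nbhs_infty_ge.
(* A Cauchy sequence of scalars is bounded, so it converges along an
   ultrafilter; being Cauchy it then converges. *)
have [G [UG ooG]] := @ultraFilterLemma nat \oo _.
have FG : ProperFilter G by exact: ultra_proper.
have [N xN] := cauchy 1 ltr01.
have [|l xl] := @bounded_ultra_cvg R s nat G x (rnorm (x N) + 1) UG.
  apply: ooG; near=> k; rewrite -[x k](subrK (x N)) (le_trans (ler_rnormD _ _))//.
  rewrite addrC lerD2l ltW// xN//; near: k; exact: nbhs_infty_ge.
exists l; apply/rnorm_cvgP => d d0.
have d20 : 0 < d / 2 by rewrite divr_gt0.
have [M xM] := cauchy _ d20; move/rnorm_cvgP: xl => /(_ _ d20) xl.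
have GM : G [set j | (M <= j)%N] by apply: ooG; exact: nbhs_infty_ge.
have [j [lj Mj]] := filter_ex (filterI xl GM).
near=> k; have Mk : (M <= k)%N by near: k; exact: nbhs_infty_ge.
rewrite -[l](subrK (x j)) -addrA (le_lt_trans (ler_rnormD _ _))//.
by have := xM j k Mj Mk; rewrite /= in lj; rewrite /x in lj *; lra.
Unshelve. all: by end_near. Qed.

Lemma pi_s_cauchy_cst z : pi_s_cauchy m (fun=> z).
Proof.
move=> e e0; exists 0%N => j k _ _; apply: (@le_lt_trans _ _ 0%E); last by rewrite lte_fin.
apply: ereal_inf_lbound; exists [::]; last by rewrite big_nil.
by apply/funext => A; rewrite subrr /tensor_of big_nil.
Qed.

(** The tensor [x (x) ... (x) x] as an element of the completion. *)
Definition completed_diag (x : X) : completed_tensor m X :=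
  exist _ _ (pi_s_cauchy_cst [:: (1, x)]).

Lemma pairing_diag q x : pairing q (completed_diag x) = q x.
Proof.
rewrite /pairing /=; have -> : pairing0 q [:: (1, x)] = q x.
  by rewrite /pairing0 big_seq1/= mul1r.
apply: (cvg_lim (@norm_hausdorff _ K^o)); exact: cvg_cst.
Qed.

Lemma dual_ball_norm (q : dual_ball m X) : (hompoly_norm (dual_ball_val q) <= 1)%E.
Proof. by case: q => q qb; exact: (set_mem qb). Qed.

Lemma dual_ball_val_surj q : (hompoly_norm q <= 1)%E ->
  exists b : dual_ball m X, dual_ball_val b = q.
Proof.
move=> q1; have qb : (q : weak_star_hompoly m X) \in @dual_ball_set R s m X by rewrite inE.
by exists (SigSub qb).
Qed.

Lemma dual_ball_eval_continuous (x : X) :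
  continuous (fun q : dual_ball m X => dual_ball_val q x : K^o).
Proof.
move=> q.
have c1 : continuous (set_val : dual_ball m X -> weak_star_hompoly m X).
  exact: initial_continuous.
have c2 : continuous (@pairing R s m X : weak_star_hompoly m X -> {ptws completed_tensor m X -> K^o}).
  exact: initial_continuous.
have c3 := @proj_continuous (completed_tensor m X) (fun=> K^o) (completed_diag x).
have -> : (fun q : dual_ball m X => dual_ball_val q x : K^o) =
    proj (completed_diag x) \o (@pairing R s m X \o set_val).
  by apply/funext => b /=; rewrite /proj pairing_diag.
apply: (@continuous_comp _ {ptws completed_tensor m X -> K^o}); last exact: c3.
by apply: (@continuous_comp _ (weak_star_hompoly m X)); [exact: c1|exact: c2].
Qed.

(** On the unit ball the weak-star topology is that of pointwise
    convergence. *)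
Lemma dual_ball_cvg (F : set_system (dual_ball m X)) (q : dual_ball m X) :
  Filter F -> (forall x, (dual_ball_val b x : K^o) @[b --> F] --> dual_ball_val q x) ->
  F --> q.
Proof.
move=> FF Fq; apply: (cvg_initial (f := @set_val _ (@dual_ball_set R s m X))).
apply: cvg_initial; apply: cvg_ptws => z.
apply/rnorm_cvgP => e e0.
have e40 : 0 < e / 4 by rewrite divr_gt0.
have [n zn] := pairing_approx z e40.
have : (pairing0 (dual_ball_val b) (sval z n) : K^o) @[b --> F] -->
    pairing0 (dual_ball_val q) (sval z n).
  exact: (cvg_lincomb Fq).
move=> /rnorm_cvgP/(_ _ e40); apply: filterS => b hb.
have h1 := zn _ (dual_ball_norm q); have h2 := zn _ (dual_ball_norm b).
rewrite rnormB in h2.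
set a := pairing _ z in h1; set a0 := pairing0 _ _ in h1 hb.
set c := pairing _ z in h2; set c0 := pairing0 _ _ in h2 hb.
change (rnorm (a - c) < e); have -> : a - c = (a - a0) + ((a0 - c0) + (c0 - c)).
  by rewrite addrA subrKA addrA subrK.
apply: (le_lt_trans (ler_rnormD _ _)).
have := ler_rnormD (a0 - c0) (c0 - c); lra.
Qed.

Lemma dual_ball_ext (p q : dual_ball m X) :
  (forall x, dual_ball_val p x = dual_ball_val q x) -> p = q.
Proof.
move=> pq; apply: val_inj; rewrite /= -[LHS]/(dual_ball_val p) -[RHS]/(dual_ball_val q).
have {pq} : hompoly_fun (dual_ball_val p) = dual_ball_val q by apply/funext.
case: (dual_ball_val p) (dual_ball_val q) => [f hf cf] [g hg cg] /= fg.
by subst g; congr HomPoly; exact: Prop_irrelevance.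
Qed.

Lemma dual_ball_hausdorff : hausdorff_space (dual_ball m X).
Proof.
move=> p q; rewrite cluster_cvgE => -[G PG [Gq pG]]; apply: dual_ball_ext => x.
have ev b : (G --> b) -> (dual_ball_val c x : K^o) @[c --> G] --> dual_ball_val b x.
  by move=> Gb; exact: (cvg_comp _ _ Gb (@dual_ball_eval_continuous x b)).
have pG' : G --> p by exact: pG.
exact: (cvg_lim_unique (ev p pG') (ev q Gq)).
Qed.

Lemma dual_ball_compact : (0 < m)%N -> compact [set: dual_ball m X].
Proof.
move=> m0; rewrite compact_ultra => F UF _.
have PF : ProperFilter F by exact: ultra_proper.
have ex x : exists l : K^o, (dual_ball_val b x : K^o) @[b --> F] --> l.
  apply: (@bounded_ultra_cvg R s _ F _ (rnorm x ^+ m) UF); apply: nearW => b.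
  exact: (hompoly_ball_bound _ (dual_ball_norm b)).
have [phi Fphi] := choice ex.
have [q0 [q01 q0phi]] := hompoly_ball_limit m0 dual_ball_norm Fphi.
have [b bq0] := dual_ball_val_surj q01.
by exists b; split=> //=; apply: dual_ball_cvg => x; rewrite bq0 q0phi; exact: Fphi.
Qed.

End DualBall.

(** * Domination theorem *)

Section RealPowers.
Context {R : realType}.

Lemma powRVK (x p : R) : 0 < p -> 0 <= x -> (x `^ p^-1) `^ p = x.
Proof. by move=> p0 x0; rewrite -powRrM mulVf ?gt_eqF// powRr1. Qed.

Lemma powRKV (x p : R) : 0 < p -> 0 <= x -> (x `^ p) `^ p^-1 = x.
Proof. by move=> p0 x0; rewrite -powRrM divff ?gt_eqF// powRr1. Qed.

Lemma ler_powRL (x y p : R) : 0 < p -> 0 <= x -> x <= y -> x `^ p <= y `^ p.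
Proof.
move=> p0 x0 xy; apply: ge0_ler_powR; rewrite ?nnegrE//; first exact: ltW.
exact: le_trans xy.
Qed.

Lemma ltr_powRL (x y p : R) : 0 < p -> 0 <= x -> x < y -> x `^ p < y `^ p.
Proof.
move=> p0 x0 xy; apply: gt0_ltr_powR; rewrite ?nnegrE//.
by rewrite (le_trans x0)// ltW.
Qed.

Lemma cvg_powR {U : Type} {F : set_system U} {FF : Filter F} (g : U -> R) (a p : R) :
  0 < p -> 0 <= a -> (forall u, 0 <= g u) ->
  g @ F --> a -> (fun u => g u `^ p) @ F --> a `^ p.
Proof.
move=> p0 a0 g0 ga; apply/cvgrPdist_lt => e e0.
have ap0 : 0 <= a `^ p by exact: powR_ge0.
have hi : a < (a `^ p + e) `^ p^-1.
  by rewrite -{1}(powRKV p0 a0) ltr_powRL ?invr_gt0// ltrDl.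
have ghi : \forall u \near F, g u `^ p < a `^ p + e.
  apply: (filterS _ (cvgr_lt _ ga _ hi)) => u gu.
  by rewrite -[ltRHS](powRVK p0) ?ltr_powRL// addr_ge0// ltW.
have glo : \forall u \near F, a `^ p - e < g u `^ p.
  have [lo|lo] := ltP (a `^ p - e) 0.
    by apply: nearW => u; rewrite (lt_le_trans lo)// powR_ge0.
  have lo' : (a `^ p - e) `^ p^-1 < a.
    by rewrite -[ltRHS](powRKV p0 a0) ltr_powRL ?invr_gt0// ltrBlDr ltrDl.
  apply: (filterS _ (cvgr_gt _ ga _ lo')) => u gu.
  by rewrite -[ltLHS](powRVK p0)// ltr_powRL// powR_ge0.
apply: filterS2 ghi glo => u h1 h2.
by rewrite ltr_norml; apply/andP; split; lra.
Qed.

End RealPowers.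

Section TensorFunctions.
Context {R : realType} {s : scalar_kind}.
Local Notation K := (scalar_field R s).
Context {m : nat} {X Y : normedModType K}.

(** The value of [P] on the tensor represented by [z]. *)
Definition tensor_value (P : X -> Y) (z : seq (K * X)) : Y :=
  \sum_(l <- z) l.1 *: P l.2.

Lemma tensor_value_ord (P : X -> Y) k (x : 'I_k -> X) (lambda : 'I_k -> K) :
  \sum_(i < k) lambda i *: P (x i) =
  tensor_value P [seq (lambda i, x i) | i <- index_enum 'I_k].
Proof. by rewrite /tensor_value big_map. Qed.

(** Padding with zero coefficients gives families of a common length. *)
Lemma tensor_value_nth (P : X -> Y) z k : (size z <= k)%N ->
  \sum_(i < k) (nth (0, 0) z i).1 *: P (nth (0, 0) z i).2 = tensor_value P z.
Proof.
move=> zk; rewrite /tensor_value (big_nth (0, 0)) (big_mkord xpredT).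
rewrite (big_ord_widen k (fun i => (nth (0, 0) z i).1 *: P (nth (0, 0) z i).2) zk).
rewrite [RHS]big_mkcond; apply: eq_bigr => i _; case: ltnP => // zi.
by rewrite nth_default//= scale0r.
Qed.

End TensorFunctions.

Section PietschDomination.
Context {R : realType} {s : scalar_kind}.
Local Notation K := (scalar_field R s).
Context {m : nat} {X Y : completeNormedModType K}.
Variables (p : R) (P : hompoly m X Y).
Hypothesis p0 : 0 < p.
Hypothesis m0 : (0 < m)%N.

(** The [p]-th power of the modulus of [q] on the tensor represented by [z]. *)
Definition tensor_power (z : seq (K * X)) (q : hompoly m X K^o) : R :=
  rnorm (tensor_value q z) `^ p.

Lemma tensor_power_ge0 z q : 0 <= tensor_power z q.
Proof. exact: powR_ge0. Qed.

Lemma tensor_power_continuous z :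
  continuous (fun q : dual_ball m X => tensor_power z (dual_ball_val q)).
Proof.
move=> q; apply: (@cvg_powR R _ (nbhs q)) p0 (rnorm_ge0 _) (fun b => rnorm_ge0 _) _.
apply: rnorm_cvg; apply: (cvg_lincomb (q := fun b : dual_ball m X => dual_ball_val b)) => x.
exact: dual_ball_eval_continuous.
Qed.

Lemma tensor_power_bounded z :
  exists2 M : R, 0 <= M & forall b : dual_ball m X, tensor_power z (dual_ball_val b) <= M.
Proof.
have [M hM] := compact_fbounded (dual_ball_compact m0) (@tensor_power_continuous z).
exists M; first by rewrite (le_trans _ (hM point)).
by move=> b; rewrite (le_trans (ler_norm _)).
Qed.

(** A weight [t] enters through the scalars, multiplied by [t^(1/p)]. *)
Lemma scaled_nth_sum (V : normedModType K) (Q : X -> V) (t : R) z k :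
  0 <= t -> (size z <= k)%N ->
  rnorm (\sum_(i < k) (scalar_of_real (t `^ p^-1) * (nth (0, 0) z i).1) *:
     Q (nth (0, 0) z i).2) `^ p = t * rnorm (tensor_value Q z) `^ p.
Proof.
move=> t0 zk; under eq_bigr do rewrite -scalerA.
rewrite -scaler_sumr (tensor_value_nth Q zk) rnormZ.
by rewrite rnorm_scalar_of_real ?powR_ge0// powRM ?powR_ge0 ?rnorm_ge0// powRVK.
Qed.

(** The summing inequality says that no nonnegative combination of the
    functions [tensor_power z] stays below the same combination of the numbers
    [(|P z| / C)^p]. *)
Lemma summing_witness : factorable_strongly_summing p P ->
  exists2 C : R, 0 < C &
  forall (r : seq (R * seq (K * X))) (e : R), all (fun l => 0 <= l.1) r -> 0 < e ->
  exists b : dual_ball m X,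
    \sum_(l <- r) l.1 * (rnorm (tensor_value P l.2) / C) `^ p <=
    \sum_(l <- r) l.1 * tensor_power l.2 (dual_ball_val b) + e.
Proof.
(* The constant is enlarged to be positive. *)
move=> [C C0 sumP]; exists (C + 1); first by rewrite ltr_wpDl.
have C1 : 0 < C + 1 by rewrite ltr_wpDl.
move=> r e r0 e0.
have [->|rn] := eqVneq r [::]; first by exists point; rewrite !big_nil add0r ltW.
pose d : R * seq (K * X) := (0, [::]).
(* A common length of the families, positive even if all are empty. *)
pose k := (\max_(l <- r) size l.2).+1.
have tge (j : 'I_(size r)) : 0 <= (nth d r j).1 by apply: (allP r0); exact: mem_nth.
have zk (j : 'I_(size r)) : (size (nth d r j).2 <= k)%N.
  rewrite /k leqW//; apply: (@leq_bigmax_seq _ _ xpredT (fun l => size l.2)) => //.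
  exact: mem_nth.
have := sumP (size r) k _ isT (fun j i => (nth (0, 0) (nth d r j).2 i).2)
  (fun j i => scalar_of_real ((nth d r j).1 `^ p^-1) * (nth (0, 0) (nth d r j).2 i).1).
rewrite lt0n size_eq0 => /(_ rn).
under eq_bigr do rewrite (scaled_nth_sum P (tge _) (zk _)).
pose B := \sum_(l <- r) l.1 * rnorm (tensor_value P l.2) `^ p.
have -> : \sum_(j < size r) (nth d r j).1 * rnorm (tensor_value P (nth d r j).2) `^ p = B.
  by rewrite /B (big_nth d) big_mkord.
move=> ineq; apply: contrapT => nob.
have sB : \sum_(l <- r) l.1 * (rnorm (tensor_value P l.2) / (C + 1)) `^ p =
    B / (C + 1) `^ p.
  rewrite /B mulr_suml; apply: eq_bigr => l _.
  rewrite powRM ?rnorm_ge0 ?invr_ge0 ?(ltW C1)// mulrA; congr (_ * _).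
  by rewrite -!powR_inv1 ?powR_ge0 ?(ltW C1)// powRAC.
rewrite sB in nob.
set A := B / _ in nob.
have ltA b : \sum_(l <- r) l.1 * tensor_power l.2 (dual_ball_val b) < A - e.
  by rewrite ltNge; apply/negP => h; apply: nob; exists b; rewrite -lerBlDr.
have Ae : 0 < A - e.
  apply: le_lt_trans (ltA point); rewrite big_seq; apply: sumr_ge0 => l lr.
  by rewrite mulr_ge0 ?tensor_power_ge0//; exact: (allP r0).
have CA : B `^ p^-1 <= C * (A - e) `^ p^-1.
  rewrite -lee_fin EFinM; apply: (le_trans ineq).
  apply: lee_wpmul2l; first by rewrite lee_fin.
  apply: ge_ereal_sup => _ [q q1 <-]; rewrite lee_fin.
  under eq_bigr do rewrite (scaled_nth_sum q (tge _) (zk _)).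
  have [b bq] := dual_ball_val_surj q1.
  apply: ler_powRL; first by rewrite invr_gt0.
    by apply: sumr_ge0 => j _; rewrite mulr_ge0 ?powR_ge0.
  have := ltW (ltA b); apply: le_trans.
  by rewrite [leRHS](big_nth d) big_mkord bq.
have B0 : 0 <= B.
  rewrite /B big_seq; apply: sumr_ge0 => l lr.
  by rewrite mulr_ge0 ?powR_ge0//; exact: (allP r0).
have : B <= C `^ p * (A - e).
  rewrite -(powRVK p0 B0) -(powRVK p0 (ltW Ae)) -powRM ?powR_ge0//.
  by apply: ler_powRL => //; exact: powR_ge0.
apply/negP; rewrite -ltNge.
apply: (@le_lt_trans _ _ ((C + 1) `^ p * (A - e))).
  by rewrite ler_pM2r// ler_powRL// lerDl.
have D0 : 0 < (C + 1) `^ p by rewrite powR_gt0.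
rewrite mulrBr /A mulrC divfK ?gt_eqF// ltrBlDr ltrDl.
by rewrite mulr_gt0.
Qed.

Theorem pietsch_measure : factorable_strongly_summing p P ->
  exists (mu : probability (g_sigma_algebraType (@open (dual_ball m X))) R) (C : R),
    [/\ regular_borel mu, 0 <= C & forall z : seq (K * X),
      ((rnorm (tensor_value P z))%:E <=
       C%:E * poweR (\int[mu]_(q in [set: dual_ball m X])
         (tensor_power z (dual_ball_val q))%:E) p^-1)%E].
Proof.
move=> /summing_witness[C C0 wit].
have [mu [rmu muP]] := @abstract_pietsch_domination R (dual_ball m X)
  dual_ball_hausdorff (dual_ball_compact m0) (seq (K * X))
  (fun z b => tensor_power z (dual_ball_val b))
  (fun z => (rnorm (tensor_value P z) / C) `^ p)
  tensor_power_continuous (fun z b => tensor_power_ge0 z _) wit.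
exists mu, C; split=> //; first exact: ltW.
move=> z; have := muP z; set I := integral _ _ _ => aI.
have Pz0 : 0 <= rnorm (tensor_value P z) / C by rewrite divr_ge0 ?rnorm_ge0// ltW.
apply: (@le_trans _ _ (C%:E * poweR ((rnorm (tensor_value P z) / C) `^ p)%:E p^-1)%E).
  by rewrite poweR_EFin powRKV// -EFinM mulrC divfK// gt_eqF.
apply: lee_wpmul2l; first by rewrite lee_fin ltW.
apply: gt0_ler_poweR => //; rewrite ?invr_ge0 ?(ltW p0)// in_itv/= leey andbT.
  by rewrite lee_fin powR_ge0.
by apply: le_trans aI; rewrite lee_fin powR_ge0.
Qed.

Lemma summing_of_measure
    (mu : probability (g_sigma_algebraType (@open (dual_ball m X))) R) (C : R) :
  0 <= C ->
  (forall z : seq (K * X), z != [::] ->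
    ((rnorm (tensor_value P z))%:E <=
     C%:E * poweR (\int[mu]_(q in [set: dual_ball m X])
       (tensor_power z (dual_ball_val q))%:E) p^-1)%E) ->
  factorable_strongly_summing p P.
Proof.
move=> C0 muP; exists C => // m1 m2 m10 m20 x lambda.
pose z j := [seq (lambda j i, x j i) | i <- index_enum 'I_m2].
have zn j : z j != [::].
  by rewrite /z; have := mem_index_enum (Ordinal m20); case: (index_enum _).
pose f j (b : dual_ball m X) := tensor_power (z j) (dual_ball_val b).
have mf j : measurable_fun [set: g_sigma_algebraType (@open (dual_ball m X))] (EFin \o f j).
  apply/measurable_EFinP; apply: continuous_measurable_borel.
  exact: tensor_power_continuous.
have f0 j b : 0 <= f j b by exact: tensor_power_ge0.
pose I j := (\int[mu]_b (f j b)%:E)%E.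
have I0 j : (0 <= I j)%E by apply: integral_ge0 => b _; rewrite lee_fin.
set S := ereal_sup _.
have fS (b : dual_ball m X) : (((\sum_(j < m1) f j b) `^ p^-1)%:E <= S)%E.
  apply: ereal_sup_ubound; exists (dual_ball_val b); first exact: dual_ball_norm.
  by congr (_ `^ _)%:E; apply: eq_bigr => j _; rewrite tensor_value_ord.
have sum0 (b : dual_ball m X) : 0 <= \sum_(j < m1) f j b by exact: sumr_ge0.
have S0 : (0 <= S)%E by apply: le_trans (fS point); rewrite lee_fin powR_ge0.
have [M MP] := choice (fun j => let: ex_intro2 M M0 h := tensor_power_bounded (z j) in
  ex_intro (fun M => 0 <= M /\ forall b : dual_ball m X, f j b <= M) M (conj M0 h)).
have Sfin : S \is a fin_num.
  rewrite ge0_fin_numE//; apply: (@le_lt_trans _ _ ((\sum_(j < m1) M j) `^ p^-1)%:E); last exact: ltry.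
  apply: ge_ereal_sup => _ [q q1 <-]; rewrite lee_fin.
  have [b <-] := dual_ball_val_surj q1.
  apply: ler_powRL; first by rewrite invr_gt0.
    by apply: sumr_ge0 => j _; exact: powR_ge0.
  by apply: ler_sum => j _; rewrite tensor_value_ord; exact: (MP j).2.
have Ifin j : I j \is a fin_num.
  rewrite ge0_fin_numE//; apply: (@le_lt_trans _ _ (M j)%:E); last exact: ltry.
  rewrite -[leRHS]mule1 -(@probability_setT _ _ _ mu) -integral_cst//.
  apply: ge0_le_integral => //.
  - by move=> b _; rewrite lee_fin.
  - exact: mf.
  - by move=> b _; rewrite lee_fin; exact: (MP j).2.
have sumI : (\sum_(j < m1) I j <= (fine S `^ p)%:E)%E.
  rewrite -ge0_integral_sum//; last by move=> j b _; rewrite lee_fin.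
  rewrite -[leRHS]mule1 -(@probability_setT _ _ _ mu) -integral_cst//.
  apply: ge0_le_integral => //.
  - by move=> b _; apply: sume_ge0 => j _; rewrite lee_fin.
  - exact: emeasurable_sum.
  - move=> b _; rewrite sumEFin lee_fin -[leLHS](powRVK p0)//.
    apply: ler_powRL => //; first exact: powR_ge0.
    by rewrite -lee_fin fineK.
rewrite -[S]fineK// -EFinM lee_fin.
have fS0 : 0 <= fine S by exact: fine_ge0.
rewrite -[leRHS](powRKV p0) ?mulr_ge0//; apply: ler_powRL; first by rewrite invr_gt0.
  by apply: sumr_ge0 => j _; exact: powR_ge0.
rewrite powRM//; apply: (@le_trans _ _ (\sum_(j < m1) C `^ p * fine (I j))).
  apply: ler_sum => j _; rewrite tensor_value_ord -/(z j).
  rewrite -[X in _ * X](powRVK p0) ?fine_ge0// -powRM ?powR_ge0//.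
  apply: ler_powRL => //; first exact: rnorm_ge0.
  have h := muP (z j) (zn j).
  by rewrite -lee_fin (le_trans h)// -/(I j) -{1}(fineK (Ifin j)) poweR_EFin -EFinM.
rewrite -mulr_sumr ler_wpM2l ?powR_ge0// -lee_fin -sumEFin.
by under eq_bigr do rewrite fineK//.
Qed.

End PietschDomination.

Theorem theorem4p3 (R : realType) (s : scalar_kind) (p : R) (m : nat)
    (X Y : completeNormedModType (scalar_field R s)) (P : hompoly m X Y)
    (hp : 1 <= p) (hm : (1 <= m)%N) :
  factorable_strongly_summing p P <->
  exists (mu : probability (g_sigma_algebraType (@open (dual_ball m X))) R)
         (C : R),
    [/\ regular_borel mu, 0 <= C &
     forall (k : nat), (0 < k)%N ->
     forall (x : 'I_k -> X) (lambda : 'I_k -> scalar_field R s),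
     ((rnorm (\sum_(i < k) lambda i *: P (x i)))%:E <=
      C%:E * poweR (\int[mu]_(q in [set: dual_ball m X])
        ((rnorm (\sum_(i < k) lambda i *: dual_ball_val q (x i))) `^ p)%:E)
        p^-1)%E].
Proof.
have p0 : 0 < p by exact: lt_le_trans hp.
split=> [/(pietsch_measure p0 hm)[mu [C [rmu C0 muP]]]|[mu [C [_ C0 muP]]]].
  exists mu, C; split=> // k _ x lambda; rewrite tensor_value_ord.
  have := muP [seq (lambda i, x i) | i <- index_enum 'I_k].
  by under eq_integral do rewrite /tensor_power -tensor_value_ord.
apply: (summing_of_measure (mu := mu) p0 hm C0) => z zn.
have z0 : (0 < size z)%N by rewrite lt0n size_eq0.
have := muP (size z) z0 (fun i => (nth (0, 0) z i).2) (fun i => (nth (0, 0) z i).1).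
rewrite (tensor_value_nth P (leqnn _)).
by under eq_integral => q _ do rewrite (tensor_value_nth (dual_ball_val q) (leqnn _)).
Qed.
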